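(* Let $\varepsilon,\alpha\in(0,1]$ and $\xi>0$. Let $p$ and $q$ both be unknown distributions over $[n]$. Then any $\xi$-differentially private $(\varepsilon,\alpha,\delta=0.2)$-augmented closeness tester for $p$ and $q$ requires $$ \Omega\left(\frac{n^{2/3}\alpha^{1/3}}{\varepsilon^{4/3}}+\frac{\sqrt n}{\varepsilon^2}+\frac{n^{1/3}}{\varepsilon^{4/3}\xi^{2/3}}+\frac{\sqrt n}{\varepsilon\sqrt{\xi}}+\frac{1}{\varepsilon\xi}\right) $$ samples.
   Context: $[n]=\{1,\dots,n\}$. For distributions $p,q$ on $[n]$, $d_{\rm TV}(p,q)=\max_{S\subseteq[n]}|p(S)-q(S)|=\frac12\|p-q\|_1$. Differential privacy: for datasets $X,X'$, $\operatorname{Ham}(X,X')$ is the number of samples in which they differ. A randomized algorithm $\mathcal A$ is $\xi$-differentially private if for all $X,X'$ with $\operatorname{Ham}(X,X')=1$ and all sets $O$ of outputs, $\Pr[\mathcal A(X)\in O]\le e^{\xi}\Pr[\mathcal A(X')\in O]$. Augmented closeness tester: a randomized algorithm $\mathcal A$ which is given as input a known distribution $\hat p$ over $[n]$ (the advice, or prediction, for $p$) and a suggested accuracy $\alpha$, receives i.i.d. samples from each of two unknown distributions $p,q$ over $[n]$, and returns a value in $\{\mathsf{accept},\mathsf{reject},\bot\}$, is an $(\varepsilon,\alpha,\delta)$-augmented closeness tester if: (1) if $p=q$, $\mathcal A$ outputs $\mathsf{reject}$ with probability at most $\delta$; (2) if $d_{\rm TV}(p,q)>\varepsilon$, $\mathcal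 A$ outputs $\mathsf{accept}$ with probability at most $\delta$; (3) if $d_{\rm TV}(p,\hat p)\le\alpha$, $\mathcal A$ outputs $\bot$ with probability at most $\delta$.
   Formalization: Stated for n ≥ 2 and ε ∈ (0, ε₀] with the Ω-constant depending on ε₀ < 1: for n = 1 or ε = 1 the always-accepting algorithm needs no samples, and no constant is uniform as ε → 1 (for α = 1 and ε = 1 − 1/(C√n), O(√n) samples suffice). *)

(* Defs.v *)
From HB Require Import structures.
From mathcomp Require Import all_boot all_order all_algebra.
From mathcomp Require Import reals.
From mathcomp.analysis Require Import sequences exp.
Set Implicit Arguments.
Unset Strict Implicit.
Unset Printing Implicit Defensive.
Import Order.TTheory GRing.Theory Num.Theory.
Local Open Scope ring_scope.

Record fdist (R : realType) (T : finType) := FDist {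
  pmf :> {ffun T -> R};
  pmf_ge0 : forall x, 0 <= pmf x;
  pmf_sum1 : \sum_x pmf x = 1 }.

Definition Pr (R : realType) (T : finType) (p : fdist R T) (S : {set T}) : R :=
  \sum_(x in S) p x.

Definition dTV (R : realType) (T : finType) (p q : fdist R T) : R :=
  \big[Num.max/0%R]_(S : {set T}) `|Pr p S - Pr q S|.

Inductive outcome := Accept | Reject | Bot.

Definition option_of_outcome (o : outcome) : option bool :=
  match o with Accept => Some true | Reject => Some false | Bot => None end.

Definition outcome_of_option (b : option bool) : outcome :=
  match b with Some true => Accept | Some false => Reject | None => Bot end.

Lemma option_of_outcomeK : cancel option_of_outcome outcome_of_option.
Proof. by case. Qed.

HB.instance Definition _ := Finite.copy outcome (can_type option_of_outcomeK).

(* [sp] samples from the first unknown distribution, [sq] from the second. *)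
Definition dataset (n sp sq : nat) : finType :=
  ({ffun 'I_sp -> 'I_n} * {ffun 'I_sq -> 'I_n})%type.

Definition Ham (n sp sq : nat) (X X' : dataset n sp sq) : nat :=
  #|[set i | X.1 i != X'.1 i]| + #|[set j | X.2 j != X'.2 j]|.

(* The advice is an input of the algorithm; the internal randomness is
   represented by the law of its output given the advice and the data. *)
Definition algorithm (R : realType) (n sp sq : nat) : Type :=
  fdist R 'I_n -> dataset n sp sq -> fdist R outcome.

(* Only the data is private: the advice is the same on both sides. *)
Definition differentially_private (R : realType) (n sp sq : nat) (xi : R)
    (A : algorithm R n sp sq) : Prop :=
  forall (phat : fdist R 'I_n) (X X' : dataset n sp sq), Ham X X' = 1%N ->
  forall O : {set outcome}, Pr (A phat X) O <= expR xi * Pr (A phat X') O.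

Definition sample_prob (R : realType) (n sp sq : nat) (p q : fdist R 'I_n)
    (X : dataset n sp sq) : R :=
  (\prod_(i < sp) p (X.1 i)) * (\prod_(j < sq) q (X.2 j)).

(* Probability of the output [o], over both the samples and the randomness. *)
Definition output_prob (R : realType) (n sp sq : nat) (A : algorithm R n sp sq)
    (phat p q : fdist R 'I_n) (o : outcome) : R :=
  \sum_(X : dataset n sp sq) sample_prob p q X * A phat X o.

Definition augmented_closeness_tester (R : realType) (n sp sq : nat)
    (eps alpha delta : R) (A : algorithm R n sp sq) : Prop :=
  forall phat p q : fdist R 'I_n,
  [/\ p = q -> output_prob A phat p q Reject <= delta,
      eps < dTV p q -> output_prob A phat p q Accept <= delta
    & dTV p phat <= alpha -> output_prob A phat p q Bot <= delta].

(* Main.v *)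
(** Everything rests on one family of pairs.  A sample is an element [y] with a
    sign [s]; the first distribution gives [(y, s)] mass [(pi y + u y s) / 2], the
    second one [(pi y - u y s) / 2], so that their distance is [sum |u|].  With
    random signs on [u] the pair is hard to tell from [u = 0], where [p = q].

    Privacy terms: a private tester accepts with a probability that is
    [xi]-Lipschitz in the Hamming distance.  Take [pi] uniform.  Flipping the sign
    of [u y] for one element changes the mean acceptance probability only to
    second order, and one sample of that second-order term can be resampled, which
    gains a factor [xi]; summing over the elements bounds the gap.

    Closeness terms: with [pi] uniform, the chi-square divergence gives the
    [sqrt n / eps ^ 2] term.  For the other one, raise [pi] by [v = 1/m] at random
    independent places, which stay within [alpha] of the advice and mask the
    collisions caused by [u].  Tilting the law of these places by the [m]-th power
    of the total mass cancels the normalization, so the likelihoods factor over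
    the elements and the divergence is bounded one element at a time. *)
Require Import Defs.
From mathcomp Require Import all_boot all_order all_algebra.
From mathcomp Require Import reals.
From mathcomp.analysis Require Import sequences exp.
From mathcomp Require Import ring lra.
Import Order.TTheory GRing.Theory Num.Theory.
Local Open Scope ring_scope.
Set Implicit Arguments.
Unset Strict Implicit.
Unset Printing Implicit Defensive.

(** * Product expectations *)

Definition upd (J Z : finType) (X : {ffun J -> Z}) (i : J) (z : Z) :
  {ffun J -> Z} := [ffun j => if j == i then z else X j].

Lemma updE (J Z : finType) (X : {ffun J -> Z}) (i : J) (z : Z) : upd X i z i = z.
Proof. by rewrite ffunE eqxx. Qed.

Lemma upd_neq (J Z : finType) (X : {ffun J -> Z}) (i j : J) (z : Z) :
  j != i -> upd X i z j = X j.
Proof. by move=> ne; rewrite ffunE (negPf ne). Qed.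

(** Expectation over independent coordinates. The laws [mu j] are bare weight functions, so
    linearity holds before any positivity or normalization is known. *)
Definition Ex (R : realType) (J Z : finType) (mu : J -> Z -> R)
    (f : {ffun J -> Z} -> R) : R :=
  \sum_(X : {ffun J -> Z}) (\prod_j mu j (X j)) * f X.

Section ProductExpectation.
Variables (R : realType) (J Z : finType) (mu : J -> Z -> R).
Implicit Types f g : {ffun J -> Z} -> R.

Lemma eq_Ex f g : f =1 g -> Ex mu f = Ex mu g.
Proof. by move=> fg; apply: eq_bigr => X _; rewrite fg. Qed.

Lemma ExD f g : Ex mu (fun X => f X + g X) = Ex mu f + Ex mu g.
Proof. by rewrite -big_split; apply: eq_bigr => X _; rewrite mulrDr. Qed.

Lemma ExZ a f : Ex mu (fun X => a * f X) = a * Ex mu f.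
Proof. by rewrite /Ex mulr_sumr; apply: eq_bigr => X _; rewrite mulrCA. Qed.

Lemma ExB f g : Ex mu (fun X => f X - g X) = Ex mu f - Ex mu g.
Proof.
rewrite -[- Ex mu g]mulN1r -ExZ -ExD; apply: eq_Ex => X; by rewrite mulN1r.
Qed.

Lemma Ex_sum (I : finType) (w : I -> R) (F : I -> {ffun J -> Z} -> R) :
  Ex mu (fun X => \sum_i w i * F i X) = \sum_i w i * Ex mu (F i).
Proof.
rewrite /Ex; under eq_bigr do rewrite mulr_sumr.
rewrite exchange_big; apply: eq_bigr => i _ /=.
by rewrite mulr_sumr; apply: eq_bigr => X _; rewrite mulrCA.
Qed.

Lemma Ex_prod (g : J -> Z -> R) :
  Ex mu (fun X => \prod_j g j (X j)) = \prod_j \sum_z mu j z * g j z.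
Proof.
by rewrite bigA_distr_bigA; apply: eq_bigr => X _; rewrite big_split.
Qed.

(** Exchanging [X i] with an independent copy [z] is an involution on the pairs [(X, z)] that
    preserves their joint weight. *)
Lemma Ex_resample i f : \sum_z mu i z = 1 ->
  Ex mu f = Ex mu (fun X => \sum_z mu i z * f (upd X i z)).
Proof.
move=> mu1; rewrite /Ex.
under [RHS]eq_bigr do rewrite mulr_sumr.
pose h (p : {ffun J -> Z} * Z) := (upd p.1 i p.2, p.1 i).
have hK : involutive h.
  move=> [X z]; rewrite /h /= updE; congr pair.
  by apply/ffunP => j; rewrite !ffunE; case: eqP => [->|].
rewrite pair_bigA /= [RHS](reindex h) /=; last by apply: onW_bij; exists h.
transitivity (\sum_(X : {ffun J -> Z}) \sum_(z : Z) (\prod_j mu j (X j)) * f X * mu i z).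
  by apply: eq_bigr => X _; rewrite -mulr_sumr mu1 mulr1.
rewrite pair_bigA /=; apply: eq_bigr => -[X z] _ /=.
rewrite (_ : upd (upd X i z) i (X i) = X); last first.
  by apply/ffunP => j; rewrite !ffunE; case: eqP => [->|].
rewrite (bigD1 i) //= [in RHS](bigD1 i) //= updE.
rewrite [in RHS](eq_bigr (fun j => mu j (X j))); last first.
  by move=> j ?; rewrite upd_neq.
by ring.
Qed.

Hypothesis mu1 : forall j, \sum_z mu j z = 1.

Lemma Ex_cst a : Ex mu (fun=> a) = a.
Proof.
have := Ex_prod (fun _ _ => 1).
under eq_Ex do rewrite big1_eq.
rewrite (eq_bigr (fun=> 1)); last first.
  by move=> j _; rewrite -[RHS](mu1 j); apply: eq_bigr => z _; rewrite mulr1.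
rewrite big1_eq => E; rewrite -[RHS]mulr1 -E -ExZ.
by apply: eq_Ex => X; rewrite mulr1.
Qed.

Hypothesis mu0 : forall j z, 0 <= mu j z.

Lemma le_Ex f g : (forall X, f X <= g X) -> Ex mu f <= Ex mu g.
Proof.
by move=> fg; apply: ler_sum => X _; rewrite ler_wpM2l// prodr_ge0.
Qed.

Lemma norm_Ex f : `|Ex mu f| <= Ex mu (fun X => `|f X|).
Proof.
apply: (le_trans (ler_norm_sum _ _ _)); apply: ler_sum => X _.
by rewrite normrM ger0_norm // prodr_ge0.
Qed.

End ProductExpectation.

Arguments eq_Ex {R J Z mu f} g _.


(** From [expR (- x) >= 1 - x], the exponential is at most [1 / (1 - x)], and [(1 - x) (1 + x + 2
    x^2) = 1 + x^2 (1 - 2 x) >= 1]. *)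
Lemma expR_le_quad (R : realType) (x : R) :
  x <= 1 / 2 -> expR x <= 1 + x + 2 * x ^+ 2.
Proof.
move=> hx; have := expR_ge1Dx (- x); rewrite expRN => h.
have e0 := expR_gt0 x.
have : (1 - x) * expR x <= 1.
  by rewrite -ler_pdivlMr // mul1r.
move=> h'; have h1 : 0 < 1 - x by lra.
rewrite -(ler_pM2l h1); apply: (le_trans h').
have : 0 <= x ^+ 2 by rewrite sqr_ge0.
nra.
Qed.

(** * Perturbed likelihoods of independent samples *)

Section Perturbation.
Variables (R : realType) (J Z : finType) (mu : J -> Z -> R) (z_ : J -> Z -> R).
Variables (w B : R) (f : {ffun J -> Z} -> R).
Hypothesis mu1 : forall j, \sum_z mu j z = 1.
Hypothesis mu0 : forall j z, 0 <= mu j z.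
Hypothesis z_le1 : forall j z, `|z_ j z| <= 1.
Hypothesis z_mean : forall j, \sum_z mu j z * z_ j z = 0.
Hypothesis z_abs : forall j, \sum_z mu j z * `|z_ j z| = w.
Hypothesis z_sqr : forall j, \sum_z mu j z * z_ j z ^+ 2 = w.
Hypothesis z_f : forall j X, `|\sum_z mu j z * (z_ j z * f (upd X j z))| <= B.

(** Likelihood ratio, against the law [mu], of reweighting the coordinates in [r] by [1 + t z_].
    Indexing by a list allows induction one coordinate at a time. *)
Definition lik (t : R) (r : seq J) (X : {ffun J -> Z}) : R :=
  \prod_(j <- r) (1 + t * z_ j (X j)).

Lemma lik_upd t r X i z : i \notin r -> lik t r (upd X i z) = lik t r X.
Proof.
move=> ir; apply: eq_big_seq => j jr; rewrite upd_neq //.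
by apply: contraNneq ir => <-.
Qed.

Lemma lik_ge0 t r X : `|t| <= 1 -> 0 <= lik t r X.
Proof.
move=> t1; apply: prodr_ge0 => j _.
have : `|t * z_ j (X j)| <= 1 by rewrite normrM mulr_ile1.
by rewrite ler_norml => /andP[]; lra.
Qed.

(** Averaging over one coordinate first, the terms linear in [z_] vanish and the quadratic one
    leaves the factor [1 + t t' w]. *)
Lemma Ex_lik2 t t' r : uniq r ->
  Ex mu (fun X => lik t r X * lik t' r X) = (1 + t * t' * w) ^+ size r.
Proof.
elim: r => [_|i r IH /= /andP[ir ur]].
  by rewrite -[RHS](Ex_cst mu1); apply: eq_Ex => X; rewrite /lik !big_nil mulr1.
rewrite (Ex_resample (i := i)) // exprS -IH // -ExZ; apply: eq_Ex => X.
under eq_bigr => z _.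
  rewrite (_ : _ * _ = (lik t r X * lik t' r X) * (mu i z
    + (t + t') * (mu i z * z_ i z) + t * t' * (mu i z * z_ i z ^+ 2))).
    over.
  rewrite /lik !big_cons -!/(lik _ r _) updE !lik_upd //; ring.
rewrite -mulr_sumr !big_split /= -!mulr_sumr mu1 z_mean z_sqr; ring.
Qed.

Lemma Ex_lik t r : uniq r -> Ex mu (lik t r) = 1.
Proof.
move=> ur; have := Ex_lik2 t 0 ur.
rewrite mulr0 mul0r addr0 expr1n => <-; apply: eq_Ex => X.
by rewrite [lik 0 _ _]big1 ?mulr1 // => j _; rewrite mul0r addr0.
Qed.

(* [A] does not see coordinate [i], so that coordinate can be averaged first. *)
Lemma Ex_resample_bound (A : {ffun J -> Z} -> R) i :
  (forall X z, A (upd X i z) = A X) ->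
  `|Ex mu (fun X => z_ i (X i) * A X * f X)| <= B * Ex mu (fun X => `|A X|).
Proof.
move=> Ai; rewrite (Ex_resample (i := i)) //.
apply: le_trans (norm_Ex mu0 _) _; rewrite -ExZ; apply: le_Ex => // X.
under eq_bigr => z _.
  rewrite updE Ai (_ : _ * _ = A X * (mu i z * (z_ i z * f (upd X i z)))).
    over.
  ring.
by rewrite -mulr_sumr normrM mulrC ler_wpM2r.
Qed.

(** Telescoping: the factor at [i] adds [t z_i] times the likelihood of the rest, which has mean 1,
    so it costs at most [t B]. *)
Lemma first_order t r : 0 <= t <= 1 -> uniq r ->
  `|Ex mu (fun X => (lik t r X - 1) * f X)| <= (size r)%:R * (t * B).
Proof.
move=> /andP[t0 t1].
elim: r => [_|i r IH /= /andP[ir ur]].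
  rewrite mul0r (_ : Ex _ _ = 0) ?normr0 // -(Ex_cst mu1 0).
  by apply: eq_Ex => X; rewrite /lik big_nil subrr mul0r.
rewrite (eq_Ex (fun X => (lik t r X - 1) * f X
   + t * (z_ i (X i) * lik t r X * f X))); last first.
  move=> X; rewrite /lik big_cons -!/(lik _ _ _); ring.
rewrite ExD ExZ; apply: le_trans (ler_normD _ _) _.
rewrite -[(size r).+1%:R]natr1 mulrDl mul1r lerD ?IH // normrM ger0_norm // ler_wpM2l //.
apply: le_trans (Ex_resample_bound _) _ => [X z|]; first by rewrite lik_upd.
rewrite (eq_Ex (lik t r)) ?Ex_lik ?mulr1 // => X.
by rewrite ger0_norm // lik_ge0 ?ger0_norm.
Qed.

(* Peeling off one factor leaves [t z_i (L t - L (- t)) / 2] times [f]: one factor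
   to average against [f], and a second one of order [t] inside the difference. *)
Lemma second_order t D r : 0 <= t <= 1 -> 0 <= B -> uniq r ->
  (forall r', uniq r' -> (size r' <= size r)%N ->
     Ex mu (fun X => `|(lik t r' X - lik (- t) r' X) / 2|) <= D) ->
  `|Ex mu (fun X => ((lik t r X + lik (-t) r X) / 2 - 1) * f X)|
    <= (size r)%:R * (t * (B * D)).
Proof.
move=> /andP[t0 t1] B0.
elim: r => [_ _|i r IH /= /andP[ir ur] hD].
  rewrite mul0r (_ : Ex _ _ = 0) ?normr0 // -(Ex_cst mu1 0).
  apply: eq_Ex => X; rewrite /lik !big_nil; by field.
rewrite (eq_Ex (fun X => ((lik t r X + lik (-t) r X) / 2 - 1) * f X
   + t * (z_ i (X i) * ((lik t r X - lik (- t) r X) / 2) * f X))); last first.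
  move=> X; rewrite /lik !big_cons -!/(lik _ _ _); by field.
rewrite ExD ExZ; apply: le_trans (ler_normD _ _) _.
rewrite -[(size r).+1%:R]natr1 mulrDl mul1r lerD ?IH //.
  by move=> r' ur' sr'; apply: hD => //; apply: leqW.
rewrite normrM ger0_norm // ler_wpM2l //.
apply: le_trans (Ex_resample_bound _) _ => [X z|]; first by rewrite !lik_upd.
by rewrite ler_wpM2l ?hD.
Qed.

(** A new coordinate changes the half difference by [t z_i] times the half sum; the half sum has
    mean 1 and [|z_i|] has mean [w]. *)
Lemma Ex_lik_diff_lin t r : 0 <= t <= 1 -> uniq r ->
  Ex mu (fun X => `|(lik t r X - lik (- t) r X) / 2|) <= (size r)%:R * (t * w).
Proof.
move=> /andP[t0 t1].
elim: r => [_|i r IH /= /andP[ir ur]].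
  rewrite mul0r -(Ex_cst mu1 0) le_Ex // => X.
  by rewrite /lik !big_nil subrr mul0r normr0.
apply: (@le_trans _ _ (Ex mu (fun X => `|(lik t r X - lik (- t) r X) / 2|
   + t * (`|z_ i (X i)| * ((lik t r X + lik (-t) r X) / 2))))).
  apply: le_Ex => // X.
  have L0 : 0 <= (lik t r X + lik (-t) r X) / 2.
    by rewrite divr_ge0 // addr_ge0 // lik_ge0 // ?normrN ger0_norm.
  rewrite -[X in _ * (_ * X)]ger0_norm // -normrM -[X in X * `|_|]ger0_norm //.
  rewrite -normrM; apply: le_trans (ler_normD _ _).
  rewrite le_eqVlt; apply/orP; left; apply/eqP; congr `| _ |.
  rewrite /lik !big_cons -!/(lik _ _ _); by field.
rewrite ExD ExZ -[(size r).+1%:R]natr1 mulrDl mul1r lerD ?IH // ler_wpM2l //.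
rewrite (Ex_resample (i := i)) //.
rewrite (eq_Ex (fun X => w * ((1 / 2) * lik t r X + (1 / 2) * lik (- t) r X))).
  by rewrite ExZ ExD !ExZ !Ex_lik //; lra.
move=> X; rewrite -(z_abs i) mulr_suml; apply: eq_bigr => z _.
rewrite updE !lik_upd //; by field.
Qed.

(* AM-GM form of Cauchy-Schwarz; past [a ^ 2 = 1/2] the trivial bound 1 suffices. *)
Lemma Ex_lik_diff_sqrt t a r : 0 <= t <= 1 -> uniq r -> 0 < a -> 0 <= w ->
  (size r)%:R * (t ^+ 2 * w) <= a ^+ 2 ->
  Ex mu (fun X => `|(lik t r X - lik (- t) r X) / 2|) <= 2 * a.
Proof.
move=> /andP[t0 t1] ur a0 w0 ha.
have nt1 : `|- t| <= 1 by rewrite normrN ger0_norm.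
have pt1 : `|t| <= 1 by rewrite ger0_norm.
case: (lerP (a ^+ 2) (1 / 2)) => [a2|a2]; last first.
  apply: (@le_trans _ _ 1); last by nra.
  apply: (@le_trans _ _ (Ex mu (fun X => 1 / 2 * lik t r X + 1 / 2 * lik (- t) r X))).
    apply: le_Ex => // X; have := lik_ge0 r X pt1; have := lik_ge0 r X nt1.
    move=> h1 h2; rewrite ler_norml; apply/andP; split; lra.
  rewrite ExD !ExZ !Ex_lik //; lra.
pose s := size r; pose y : R := t ^+ 2 * w.
have y0 : 0 <= y by rewrite mulr_ge0 // sqr_ge0.
have sy0 : 0 <= s%:R * y by rewrite mulr_ge0.
have E2 : Ex mu (fun X => ((lik t r X - lik (- t) r X) / 2) ^+ 2)
    = ((1 + y) ^+ s - (1 - y) ^+ s) / 2.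
  rewrite (eq_Ex (fun X => 1 / 4 * (lik t r X * lik t r X)
    + 1 / 4 * (lik (- t) r X * lik (- t) r X)
    + (- 1 / 2) * (lik t r X * lik (- t) r X))); last by move=> X; by field.
  rewrite !ExD !ExZ !Ex_lik2 //.
  have -> : 1 + t * t * w = 1 + y by rewrite /y; ring.
  have -> : 1 + - t * - t * w = 1 + y by rewrite /y; ring.
  have -> : 1 + t * - t * w = 1 - y by rewrite /y; ring.
  by rewrite -/s; field.
have hy : s%:R * y <= a ^+ 2 by [].
(* Together with Bernoulli's inequality [lo], this bounds the second moment [E2] by [3 s y / 2],
   hence by [2 a^2]. *)
have up : (1 + y) ^+ s <= 1 + 2 * (s%:R * y).
  apply: (@le_trans _ _ (expR y ^+ s)).
    by rewrite lerXn2r ?nnegrE ?expR_ge0 ?expR_ge1Dx ?addr_ge0.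
  rewrite -expRM_natl; apply: (le_trans (expR_le_quad _)); nra.
have lo : 1 - s%:R * y <= (1 - y) ^+ s.
  have y1 : s%:R * y <= 1 by lra.
  move: (s) y1 => n; elim: n => [|n IH]; first by rewrite mul0r subr0.
  rewrite -natr1 mulrDl mul1r => y1.
  have n0 : 0 <= n%:R * y by rewrite mulr_ge0.
  have {}IH := IH ltac:(lra); rewrite exprS.
  have : (1 - y) * (1 - n%:R * y) <= (1 - y) * (1 - y) ^+ n by rewrite ler_wpM2l //; lra.
  by have := mulr_ge0 y0 n0; nra.
apply: (@le_trans _ _ (Ex mu (fun X => a / 2 +
    (2 * a)^-1 * ((lik t r X - lik (- t) r X) / 2) ^+ 2))).
  apply: le_Ex => // X; set u := (_ / 2).
  rewrite -(real_normK (num_real u)); set v := `|u|.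
  have : 0 <= (2 * a)^-1 * (v - a) ^+ 2.
    by rewrite mulr_ge0 ?sqr_ge0 // invr_ge0; lra.
  have -> : (2 * a)^-1 * (v - a) ^+ 2 = (2 * a)^-1 * v ^+ 2 - v + a / 2.
    by field; lra.
  lra.
rewrite ExD Ex_cst // ExZ E2.
have : (2 * a)^-1 * (((1 + y) ^+ s - (1 - y) ^+ s) / 2) <= (2 * a)^-1 * (2 * a ^+ 2).
  rewrite ler_wpM2l //; first by rewrite invr_ge0; lra.
  move: ha; rewrite -/s -/y; lra.
have -> : (2 * a)^-1 * (2 * a ^+ 2) = a by field; lra.
lra.
Qed.

End Perturbation.

(** * From testers to product expectations *)

Section Push.
Variables (R : realType) (Z T : finType) (iota : Z -> T).

Definition is_push (mu : Z -> R) (p : fdist R T) : Prop :=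
  forall i, p i = \sum_(z | iota z == i) mu z.

Lemma push_exists (mu : Z -> R) :
  (forall z, 0 <= mu z) -> \sum_z mu z = 1 -> exists p, is_push mu p.
Proof.
move=> mu0 mu1; pose f := [ffun i => \sum_(z | iota z == i) mu z].
have f0 i : 0 <= f i by rewrite ffunE sumr_ge0.
have f1 : \sum_i f i = 1.
  rewrite -mu1 (partition_big iota xpredT) //=.
  by apply: eq_bigr => i _; rewrite ffunE.
by exists (FDist f0 f1) => i; rewrite ffunE.
Qed.

Lemma Pr_push mu p (S : {set T}) : is_push mu p ->
  Pr p S = \sum_(z | iota z \in S) mu z.
Proof.
move=> hp; rewrite (partition_big iota (mem S)) //=; apply: eq_bigr => i iS.
rewrite hp; apply: eq_bigl => z.
by case: eqP => [->|]; rewrite ?andbF // iS.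
Qed.

(** One-sided domination suffices: the bound on [p S - p' S], applied to the complement of [S],
    gives the reverse one. *)
Lemma dTV_push_le mu mu' e p p' (a : R) : is_push mu p -> is_push mu' p' ->
  0 <= a -> (forall z, 0 <= e z) -> \sum_z e z <= a ->
  (forall z, mu z <= mu' z + e z) -> dTV p p' <= a.
Proof.
move=> hp hp' a0 e0 ea le_mu.
have le_Pr S : Pr p S <= Pr p' S + a.
  rewrite (Pr_push _ hp) (Pr_push _ hp').
  apply: (@le_trans _ _ (\sum_(z | iota z \in S) (mu' z + e z))); first exact: ler_sum.
  rewrite big_split lerD2l; apply: le_trans ea.
  by rewrite [leRHS](bigID (fun z => iota z \in S)) /= lerDl sumr_ge0.
have PrC (q : fdist R T) (S : {set T}) : Pr q S = 1 - Pr q (~: S).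
  rewrite -(pmf_sum1 q) [in RHS](bigID (mem S)) /= /Pr.
  rewrite [X in _ + X - _](eq_bigl (fun i => i \in ~: S)) ?addrK // => i.
  by rewrite !inE.
apply: bigmax_le => // S _; rewrite ler_norml; apply/andP; split; last first.
  by rewrite lerBlDl; have := le_Pr S; lra.
rewrite (PrC p) (PrC p'); have := le_Pr (~: S); lra.
Qed.

(** Each [nu j] is expanded over a fibre of [iota]; after distributing the product, only the image
    of [X] survives for each [X]. *)
Lemma Ex_push (J : finType) (nu : J -> T -> R) (mu : J -> Z -> R) g :
  (forall j i, nu j i = \sum_(z | iota z == i) mu j z) ->
  Ex nu g = Ex mu (fun X => g [ffun j => iota (X j)]).
Proof.
move=> hnu; rewrite /Ex.
transitivity (\sum_(X' : {ffun J -> T}) \sum_(X : {ffun J -> Z})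
    (\prod_j mu j (X j)) * (X' == [ffun j => iota (X j)])%:R * g X').
  apply: eq_bigr => X' _; rewrite -mulr_suml; congr (_ * _).
  rewrite (eq_bigr (fun j => \sum_z mu j z * (iota z == X' j)%:R)); last first.
    move=> j _; rewrite hnu big_mkcond; apply: eq_bigr => z _.
    by case: ifP; rewrite (mulr1, mulr0).
  rewrite bigA_distr_bigA; apply: eq_bigr => X _; rewrite big_split /=.
  congr (_ * _); case: eqP => [->|ne].
    by rewrite big1 // => j _; rewrite ffunE eqxx.
  have /existsP[j /negPf hj] : [exists j, iota (X j) != X' j].
    apply: contra_notT ne; rewrite negb_exists => /forallP h.
    by apply/ffunP => j; rewrite ffunE; apply/esym/eqP; rewrite -[_ == _]negbK.
  by rewrite (bigD1 j) //= hj mul0r.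
rewrite exchange_big; apply: eq_bigr => X _ /=.
rewrite (bigD1 [ffun j => iota (X j)]) //= eqxx mulr1 [X in _ + X]big1 ?addr0 // => X' ne.
by rewrite (negPf ne) mulr0 mul0r.
Qed.

End Push.

(** * Both samples as one product space, and privacy as a Lipschitz bound *)

Section TwoSamples.
Variables (R : realType) (n sp sq : nat).
Notation J := ('I_sp + 'I_sq)%type.

Definition to_data (X : {ffun J -> 'I_n}) : dataset n sp sq :=
  ([ffun i => X (inl i)], [ffun j => X (inr j)]).

Lemma output_prob_Ex (A : algorithm R n sp sq) phat p q o :
  output_prob A phat p q o =
  Ex (fun (j : J) i => if j is inl _ then p i else q i)
     (fun X => A phat (to_data X) o).
Proof.
pose h (X : dataset n sp sq) : {ffun J -> 'I_n} :=
  [ffun j => match j with inl i => X.1 i | inr i => X.2 i end].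
have hK : cancel h to_data.
  by move=> [X1 X2]; congr pair; apply/ffunP => i; rewrite !ffunE.
have Kh : cancel to_data h.
  by move=> X; apply/ffunP => -[] i; rewrite !ffunE.
rewrite /Ex (reindex h) /=; last by apply: onW_bij; exists to_data.
apply: eq_bigr => X _; rewrite hK; congr (_ * _).
rewrite /sample_prob big_sumType /=.
by congr (_ * _); apply: eq_bigr => i _; rewrite ffunE.
Qed.

Definition pull (Z : finType) (iota : Z -> 'I_n) (A : algorithm R n sp sq)
    phat o (X : {ffun J -> Z}) : R := A phat (to_data [ffun j => iota (X j)]) o.

Lemma output_prob_push (Z : finType) (iota : Z -> 'I_n) mu mu' p q
    (A : algorithm R n sp sq) phat o : is_push iota mu p -> is_push iota mu' q ->
  output_prob A phat p q o =
  Ex (fun (j : J) z => if j is inl _ then mu z else mu' z)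
     (pull iota A phat o).
Proof.
move=> hp hq; rewrite output_prob_Ex.
by apply: (Ex_push (iota := iota)) => -[] j i; rewrite (hp, hq).
Qed.

Lemma sum_outcome (F : outcome -> R) :
  \sum_o F o = F Accept + F Reject + F Bot.
Proof.
rewrite (bigD1 Accept) //= (bigD1 Reject) //= (bigD1 Bot) //= big_pred0.
  by rewrite addr0 addrA.
by case.
Qed.

Lemma sum_output_prob (A : algorithm R n sp sq) phat p q :
  output_prob A phat p q Accept + output_prob A phat p q Reject
  + output_prob A phat p q Bot = 1.
Proof.
rewrite !output_prob_Ex -!ExD.
rewrite (eq_Ex (fun=> 1)) ?Ex_cst //.
  by case=> _; exact: pmf_sum1.
by move=> X; rewrite -sum_outcome pmf_sum1.
Qed.

Lemma pmf_le1 (T : finType) (p : fdist R T) x : p x <= 1.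
Proof.
by rewrite -(pmf_sum1 p) (bigD1 x) //= lerDl sumr_ge0 // => i _; apply: pmf_ge0.
Qed.

(** With equal distributions near the advice, conditions (1) and (3) bound both other outcomes by
    [delta]. *)
Lemma null_accept (A : algorithm R n sp sq) eps alpha delta phat p :
  augmented_closeness_tester eps alpha delta A -> dTV p phat <= alpha ->
  1 - 2 * delta <= output_prob A phat p p Accept.
Proof.
move=> hA hp; have [/(_ erefl) h1 _ /(_ hp) h3] := hA phat p p.
have := sum_output_prob A phat p p; lra.
Qed.

(** The multiplicative guarantee becomes additive because probabilities are at most 1 and
    [1 - xi <= expR (- xi)]. *)
Lemma dp_lipschitz (Z : finType) (iota : Z -> 'I_n) (A : algorithm R n sp sq)
    xi phat o (X : {ffun J -> Z}) j z z' : 0 <= xi ->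
  differentially_private xi A ->
  `|pull iota A phat o (upd X j z) - pull iota A phat o (upd X j z')| <= xi.
Proof.
move=> xi0 hA; set f := pull iota A phat o.
have main a b : f (upd X j a) - f (upd X j b) <= xi.
  (* Privacy speaks of Hamming distance exactly 1, so symbols with the same image, which give the
     same dataset, are treated apart. *)
  have [e|ne] := eqVneq (iota a) (iota b).
    rewrite (_ : f _ = f (upd X j b)) ?subrr // /f /pull; congr (A _ (to_data _) _).
    by apply/ffunP => i; rewrite !ffunE; case: eqP.
  have hH : Ham (to_data [ffun i => iota (upd X j a i)])
                (to_data [ffun i => iota (upd X j b i)]) = 1%N.
    rewrite /Ham; case: j ne => j ne.
      rewrite (_ : [set i | _] = [set j]); last first.
        apply/setP => i; rewrite !inE !ffunE.
        case: (eqVneq i j) => [->|nij]; first by rewrite eqxx.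
        have /negPf -> : (inl i : J) != inl j by [].
        by rewrite eqxx.
      rewrite (_ : [set i | _] = set0) ?cards1 ?cards0 //.
      by apply/setP => i; rewrite !inE !ffunE /= eqxx.
    rewrite (_ : [set i | _] = set0); last first.
      by apply/setP => i; rewrite !inE !ffunE /= eqxx.
    rewrite (_ : [set i | _] = [set j]) ?cards1 ?cards0 //.
    apply/setP => i; rewrite !inE !ffunE /=.
    case: (eqVneq i j) => [->|nij]; first by rewrite eqxx.
    have /negPf -> : (inr i : J) != inr j by [].
        by rewrite eqxx.
  have := hA phat _ _ hH [set o]; rewrite /Pr !big_set1 -!/(f _) => hle.
  have fa1 : f (upd X j a) <= 1 by exact: pmf_le1.
  have fa0 : 0 <= f (upd X j a) by exact: pmf_ge0.
  have : expR (- xi) * f (upd X j a) <= f (upd X j b).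
    by rewrite expRN mulrC ler_pdivrMr ?expR_gt0 // mulrC.
  have : (1 - xi) * f (upd X j a) <= expR (- xi) * f (upd X j a).
    by rewrite ler_wpM2r // expR_ge1Dx.
  have : xi * f (upd X j a) <= xi by rewrite ler_piMr.
  lra.
by rewrite ler_norml; apply/andP; split; [have := main z' z|have := main z z']; lra.
Qed.

End TwoSamples.

(** * Pairs of signed densities *)

Definition sgb (R : realType) (s : bool) : R := (-1) ^+ s.

Lemma sgbK (R : realType) (s : bool) : sgb R s * sgb R s = 1.
Proof. by rewrite /sgb -expr2 sqrr_sign. Qed.

Definition sdens (R : realType) (Y : finType) (pi u : Y -> R) (z : Y * bool) : R :=
  (pi z.1 + u z.1 * sgb R z.2) / 2.

Section SignedDensity.
Variables (R : realType) (Y : finType).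
Implicit Types (pi u r : Y -> R).

Lemma sum_bool (F : bool -> R) : \sum_b F b = F false + F true.
Proof. by rewrite big_bool addrC. Qed.

Lemma sum_sdens pi u : \sum_z sdens pi u z = \sum_y pi y.
Proof.
rewrite (eq_bigr (fun z => sdens pi u (z.1, z.2))) => [|[]] //.
rewrite -(pair_bigA _ (fun y s => sdens pi u (y, s))) /=.
by apply: eq_bigr => y _; rewrite sum_bool /sdens /sgb /=; field.
Qed.

Lemma sdens_ge0 pi u z : `|u z.1| <= pi z.1 -> 0 <= sdens pi u z.
Proof.
move=> h; rewrite divr_ge0 //; have : `|u z.1 * sgb R z.2| <= pi z.1.
  by rewrite normrM normr_sign mulr1.
by rewrite ler_norml; case/andP; lra.
Qed.

(** The witness set keeps, for each [y], the sign favoured by [p]; every such point contributes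
    [r y] to the difference. *)
Lemma dTV_signed n (iota : Y * bool -> 'I_n) pi r (sigma : Y -> bool) p q :
  injective iota -> (forall y, 0 <= r y) ->
  is_push iota (sdens pi (fun y => r y * sgb R (sigma y))) p ->
  is_push iota (sdens pi (fun y => - (r y * sgb R (sigma y)))) q ->
  \sum_y r y <= dTV p q.
Proof.
move=> inj r0 hp hq.
pose S := iota @: [set z | z.2 == sigma z.1].
apply: le_trans (@le_bigmax _ _ _ _ _ S).
rewrite (Pr_push _ hp) (Pr_push _ hq) -sumrB.
apply: le_trans (ler_norm _); rewrite le_eqVlt; apply/orP; left; apply/eqP.
rewrite (eq_bigl (fun z => z.2 == sigma z.1)); last first.
  by move=> z; rewrite mem_imset // inE.
rewrite (eq_bigr (fun z => r z.1)); last first.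
  move=> [y s] /= /eqP ->; rewrite /sdens /=.
  transitivity (r y * (sgb R (sigma y) * sgb R (sigma y))); last by rewrite sgbK mulr1.
  by field.
rewrite (reindex_onto (fun y => (y, sigma y)) fst) /=; last first.
  by move=> [y s] /= /eqP ->.
by apply: eq_bigl => y; rewrite !eqxx.
Qed.

End SignedDensity.

(** * Sign perturbations of the uniform distribution *)

Lemma eq_Ex_dens (R : realType) (J Z : finType) (mu nu : J -> Z -> R) f :
  (forall j z, mu j z = nu j z) -> Ex mu f = Ex nu f.
Proof.
move=> h; apply: eq_bigr => X _; congr (_ * _).
by apply: eq_bigr => j _; rewrite h.
Qed.

Lemma size_index_enum (T : finType) : size (index_enum T) = #|T|.
Proof. by rewrite -sum1_size -sum1_card. Qed.

Definition coin (R : realType) (Y : finType) (_ : Y) (_ : bool) : R := 1 / 2.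
Arguments coin R {Y}.

Lemma coin_sum1 (R : realType) (Y : finType) (y : Y) : \sum_s coin R y s = 1.
Proof. by rewrite sum_bool /coin; field. Qed.

Lemma coin_ge0 (R : realType) (Y : finType) (y : Y) s : 0 <= coin R y s.
Proof. by rewrite /coin divr_ge0. Qed.

Section UniformPerturbation.
Variables (R : realType) (Y J : finType) (eta : J -> bool) (theta xi : R).
Variable f : {ffun J -> Y * bool} -> R.
Notation k := (#|Y|%:R : R).
Hypothesis Ygt0 : (0 < #|Y|)%N.
Hypothesis theta01 : 0 <= theta <= 1.
Hypothesis xi0 : 0 <= xi.
Hypothesis f_lip : forall X j z z', `|f (upd X j z) - f (upd X j z')| <= xi.

(** [eta j] tells which of the two distributions sample [j] comes from; the two carry opposite
    perturbations. *)
Definition pert (u : Y -> R) (j : J) : Y * bool -> R :=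
  sdens (fun=> k^-1) (fun y => sgb R (eta j) * u y).

Let k0 : 0 < k. Proof. by rewrite ltr0n. Qed.

Lemma normr_sgb s : `|sgb R s| = 1.
Proof. by rewrite /sgb normr_sign. Qed.

Lemma pert_sum1 u j : \sum_z pert u j z = 1.
Proof.
by rewrite sum_sdens sumr_const -[LHS]mulr_natr mulVf // gt_eqF.
Qed.

Lemma pert_ge0 u j z : (forall y, `|u y| <= k^-1) -> 0 <= pert u j z.
Proof. by move=> hu; rewrite sdens_ge0 // normrM normr_sgb mul1r. Qed.

Lemma sum_pair (F : Y * bool -> R) :
  \sum_z F z = \sum_y (F (y, false) + F (y, true)).
Proof.
rewrite (eq_bigr (fun z => F (z.1, z.2))) => [|[]] //.
rewrite -(pair_bigA _ (fun y s => F (y, s))) /=.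
by apply: eq_bigr => y _; rewrite sum_bool.
Qed.

Section OneGroup.
Variables (i : Y) (u : Y -> R).
Hypothesis ui0 : u i = 0.
Hypothesis u_le : forall y, `|u y| <= k^-1.

Let z_ (j : J) (z : Y * bool) : R := (z.1 == i)%:R * (sgb R (eta j) * sgb R z.2).

Let sum_z (j : J) (F : Y * bool -> R) (G : R -> R) : G 0 = 0 ->
  \sum_z pert u j z * (G (z_ j z) * F z)
  = (2 * k)^-1 * (G (sgb R (eta j)) * F (i, false) + G (- sgb R (eta j)) * F (i, true)).
Proof.
move=> G0; rewrite sum_pair (bigD1 i) //= big1 ?addr0.
  rewrite /pert /sdens /z_ /= ui0 eqxx /sgb /= expr0 expr1.
  rewrite !mulr0 !mul0r addr0 mulr1 !mul1r mulrN1.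
  by field; rewrite gt_eqF.
by move=> y /negPf yi; rewrite /z_ /= yi !mul0r G0 !mul0r !mulr0 addr0.
Qed.

(** Averaging over the two signs at [i] leaves the even part of the likelihood, to which
    [second_order] applies. [D] bounds the mean odd part, through [Ex_lik_diff_lin] or
    [Ex_lik_diff_sqrt]. *)
Lemma group_step (D : R) :
  #|J|%:R * (theta / k) <= D \/
    0 < D /\ #|J|%:R * (theta ^+ 2 / k) <= (D / 2) ^+ 2 ->
  `| (Ex (pert (fun y => if y == i then theta / k else u y)) f
      + Ex (pert (fun y => if y == i then - (theta / k) else u y)) f) / 2
     - Ex (pert u) f| <= #|J|%:R * (theta * (xi / (2 * k) * D)).
Proof.
move=> hD.
have mu1 := pert_sum1 u.
have mu0 j z := pert_ge0 j z u_le.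
have kN0 : k != 0 by rewrite gt_eqF.
have k2 : 0 < (2 * k)^-1 by rewrite invr_gt0 mulr_gt0.
have z_le1 j z : `|z_ j z| <= 1.
  by rewrite /z_ !normrM !normr_sgb !mulr1 normr_nat; case: (_ == _).
have simp j (G : R -> R) : G 0 = 0 ->
    \sum_z pert u j z * G (z_ j z)
    = (2 * k)^-1 * (G (sgb R (eta j)) + G (- sgb R (eta j))).
  move=> G0; have := sum_z j (fun=> 1) G0; rewrite !mulr1 => <-.
  by apply: eq_bigr => z _; rewrite mulr1.
have z_mean j : \sum_z pert u j z * z_ j z = 0.
  by rewrite (simp j id) // subrr mulr0.
have z_abs j : \sum_z pert u j z * `|z_ j z| = k^-1.
  by rewrite (simp j Num.norm) ?normr0 // normrN normr_sgb; field.
have z_sqr j : \sum_z pert u j z * z_ j z ^+ 2 = k^-1.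
  by rewrite (simp j (fun x => x ^+ 2)) ?expr0n // sqrrN expr2 sgbK; field.
(* Only the two symbols at [i] count, each of mass [1 / (2 k)], and exchanging them moves [f] by at
   most [xi]. *)
have z_f j X : `|\sum_z pert u j z * (z_ j z * f (upd X j z))| <= xi / (2 * k).
  rewrite (sum_z j (fun z => f (upd X j z)) (G := id)) // mulNr -mulrBr.
  rewrite !normrM normr_sgb mul1r mulrC (gtr0_norm k2).
  by rewrite ler_wpM2r // ltW.
(* As [u i = 0], installing the value [t / k] at [i] is exactly the reweighting [lik t]. *)
have shift t : Ex (pert (fun y => if y == i then t / k else u y)) f
    = Ex (pert u) (fun X => lik z_ t (index_enum J) X * f X).
  apply: eq_bigr => X _; rewrite mulrA /lik -big_split /=; congr (_ * _).
  apply: eq_bigr => j _; rewrite /pert /sdens /z_; case: (eqVneq (X j).1 i) => [->|_].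
    by rewrite ui0 mul1r; field.
  by rewrite mul0r mulr0 addr0 mulr1.
have B0 : 0 <= xi / (2 * k) by rewrite divr_ge0 // mulr_ge0 // ltW.
have k0' : 0 <= k^-1 by rewrite invr_ge0 ltW.
have := second_order mu1 mu0 z_f (D := D) theta01 B0
  (index_enum_uniq J).
rewrite size_index_enum => h.
rewrite -[- (theta / k)]mulNr !shift.
apply: le_trans (h _); last first.
  move=> r ur; rewrite -(ler_nat R) => sr; case: hD => [hD|[D0 hD]].
    apply: le_trans hD.
    apply: le_trans (Ex_lik_diff_lin mu1 mu0 z_le1 z_mean z_abs z_sqr theta01 ur) _.
    by rewrite ler_wpM2r // mulr_ge0 //; case/andP: theta01.
  have -> : D = 2 * (D / 2) by field.
  apply: (Ex_lik_diff_sqrt mu1 mu0 z_le1 z_mean z_sqr) => //; first lra.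
  by apply: le_trans hD; rewrite ler_wpM2r // mulr_ge0 // sqr_ge0.
rewrite le_eqVlt; apply/orP; left; apply/eqP; congr `| _ |.
rewrite [RHS](eq_Ex (fun X => 1 / 2 * (lik z_ theta (index_enum J) X * f X)
  + 1 / 2 * (lik z_ (- theta) (index_enum J) X * f X) - f X)); last first.
  by move=> X; field.
rewrite ExB ExD !ExZ.
by field.
Qed.

End OneGroup.

Lemma random_signs (D : R) :
  #|J|%:R * (theta / k) <= D \/
    0 < D /\ #|J|%:R * (theta ^+ 2 / k) <= (D / 2) ^+ 2 ->
  `| Ex (coin R) (fun sigma => Ex (pert (fun y => theta / k * sgb R (sigma y))) f)
     - Ex (pert (fun=> 0)) f| <= #|J|%:R * theta * xi * D / 2.
Proof.
move=> hD; have /andP[t0 t1] := theta01.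
have kN0 : k != 0 by rewrite gt_eqF.
pose u (r : seq Y) (sigma : {ffun Y -> bool}) y : R :=
  if y \in r then theta / k * sgb R (sigma y) else 0.
have u_le r sigma y : `|u r sigma y| <= k^-1.
  rewrite /u; case: ifP => _; last by rewrite normr0 invr_ge0 ltW.
  have k0' : 0 <= k^-1 by rewrite invr_ge0 ltW.
  by rewrite normrM normr_sgb mulr1 ger0_norm ?mulr_ge0 // ler_piMl.
have H r : uniq r ->
  `| Ex (coin R) (fun sigma => Ex (pert (u r sigma)) f) - Ex (pert (fun=> 0)) f|
   <= (size r)%:R * (#|J|%:R * (theta * (xi / (2 * k) * D))).
  elim: r => [_|i r IH /= /andP[ir ur]].
    rewrite mul0r (_ : Ex _ _ = Ex (pert (fun=> 0)) f) ?subrr ?normr0 //.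
    by rewrite -[RHS](Ex_cst (@coin_sum1 R Y)).
  rewrite (Ex_resample (i := i)) ?coin_sum1 // -natr1 mulrDl mul1r [leRHS]addrC.
  rewrite -[X in `|X|](subrKA (Ex (coin R) (fun sigma => Ex (pert (u r sigma)) f))).
  apply: le_trans (ler_normD _ _) _; rewrite lerD ?IH //.
  rewrite -ExB -[leRHS](Ex_cst (@coin_sum1 R Y)).
  apply: le_trans (norm_Ex (@coin_ge0 R Y) _) _; apply: (le_Ex (@coin_ge0 R Y)) => sigma.
  have ui0 : u r sigma i = 0 by rewrite /u (negPf ir).
  have := group_step ui0 (u_le r sigma) hD.
  rewrite sum_bool /coin; apply: le_trans.
  have E b : Ex (pert (u (i :: r) (upd sigma i b))) f =
      Ex (pert (fun y => if y == i then theta / k * sgb R b else u r sigma y)) f.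
    apply: eq_Ex_dens => j z; rewrite /pert /sdens; congr ((_ + _ * _ * _) / _).
    rewrite /u in_cons; case: (eqVneq z.1 i) => [->|ne] /=; first by rewrite updE.
    by rewrite upd_neq.
  rewrite !E /sgb expr0 expr1 mulr1 mulrN1 le_eqVlt; apply/orP; left; apply/eqP.
  by congr `| _ |; field.
have := H _ (index_enum_uniq Y); rewrite size_index_enum => h.
have -> : #|J|%:R * theta * xi * D / 2 = #|Y|%:R * (#|J|%:R * (theta * (xi / (2 * k) * D))).
  by field.
rewrite (eq_Ex (fun sigma => Ex (pert (u (index_enum Y) sigma)) f)) // => sigma.
apply: eq_Ex_dens => j z; rewrite /pert /sdens /u.
by rewrite mem_index_enum.
Qed.

(** With all signs equal the score of every sample is [1] or [-1], and the first-order bound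
    suffices with [B = xi / 2]. *)
Lemma fixed_signs :
  `| Ex (pert (fun=> theta / k)) f - Ex (pert (fun=> 0)) f|
  <= #|J|%:R * (theta * (xi / 2)).
Proof.
have kN0 : k != 0 by rewrite gt_eqF.
have k2 : 0 < (2 * k)^-1 by rewrite invr_gt0 mulr_gt0.
have zu (y : Y) : `|(0 : R)| <= k^-1 by rewrite normr0 invr_ge0 ltW.
have mu1 := pert_sum1 (fun=> 0).
have mu0 j z := @pert_ge0 (fun=> 0) j z zu.
pose z_ (j : J) (z : Y * bool) : R := sgb R (eta j) * sgb R z.2.
have z_le1 j z : `|z_ j z| <= 1 by rewrite normrM !normr_sgb mulr1.
have z_mean j : \sum_z pert (fun=> 0) j z * z_ j z = 0.
  rewrite sum_pair big1 // => y _; rewrite /pert /sdens /z_ /sgb /= expr0 expr1.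
  by field.
have z_sqr j : \sum_z pert (fun=> 0) j z * z_ j z ^+ 2 = 1.
  rewrite -(mu1 j); apply: eq_bigr => z _.
  by rewrite exprMn !expr2 !sgbK !mulr1.
have z_f j X : `|\sum_z pert (fun=> 0) j z * (z_ j z * f (upd X j z))| <= xi / 2.
  rewrite sum_pair; apply: le_trans (ler_norm_sum _ _ _) _.
  apply: (@le_trans _ _ (\sum_(y : Y) (2 * k)^-1 * xi)); last first.
    by rewrite sumr_const -[leLHS]mulr_natr le_eqVlt; apply/orP; left; apply/eqP; field.
  apply: ler_sum => y _; rewrite /pert /sdens /z_ /sgb /= expr0 expr1.
  set a := f _; set b := f _.
  rewrite (_ : _ + _ = (2 * k)^-1 * ((-1) ^+ eta j * (a - b))); last by field.
  rewrite !normrM normr_sign mul1r (gtr0_norm k2).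
  by apply: ler_wpM2l; [exact: ltW|exact: f_lip].
have := first_order mu1 mu0 z_le1 z_mean z_sqr z_f theta01 (index_enum_uniq J).
rewrite size_index_enum; apply: le_trans.
rewrite [X in _ <= `|X|](eq_Ex (fun X => lik z_ theta (index_enum J) X * f X - f X)); last first.
  by move=> X; ring.
rewrite ExB le_eqVlt; apply/orP; left; apply/eqP; congr `| _ - _ |.
apply: eq_bigr => X _; rewrite mulrA /lik -big_split /=; congr (_ * _).
apply: eq_bigr => j _; rewrite /pert /sdens /z_; by field.
Qed.

End UniformPerturbation.

(** * Chi-square bound for tilted mixtures *)

Lemma sum_ffun_pair (V : nmodType) (J A B : finType) (F : {ffun J -> A * B} -> V) :
  \sum_X F X
  = \sum_(y : {ffun J -> A}) \sum_(s : {ffun J -> B}) F [ffun j => (y j, s j)].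
Proof.
pose h (p : {ffun J -> A} * {ffun J -> B}) : {ffun J -> A * B} :=
  [ffun j => (p.1 j, p.2 j)].
pose g (X : {ffun J -> A * B}) : {ffun J -> A} * {ffun J -> B} :=
  ([ffun j => (X j).1], [ffun j => (X j).2]).
rewrite pair_bigA (reindex h) //; apply: onW_bij; exists g.
  by move=> [y s]; congr pair; apply/ffunP => j; rewrite !ffunE.
by move=> X; apply/ffunP => j; rewrite !ffunE; case: (X j).
Qed.

Lemma Ex_pair (R : realType) (J A B : finType) (m1 : J -> A -> R)
    (m2 : J -> B -> R) (g : {ffun J -> A * B} -> R) :
  Ex (fun j p => m1 j p.1 * m2 j p.2) g =
  Ex m1 (fun y => Ex m2 (fun s => g [ffun j => (y j, s j)])).
Proof.
rewrite /Ex sum_ffun_pair; apply: eq_bigr => y _; rewrite mulr_sumr.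
apply: eq_bigr => s _; rewrite mulrA -big_split /=; congr (_ * _).
by apply: eq_bigr => j _; rewrite ffunE.
Qed.

Lemma Ex_exchange (R : realType) (J J' A B : finType) (m1 : J -> A -> R)
    (m2 : J' -> B -> R) (F : {ffun J -> A} -> {ffun J' -> B} -> R) :
  Ex m1 (fun x => Ex m2 (F x)) = Ex m2 (fun y => Ex m1 (F^~ y)).
Proof. by rewrite {2}/Ex Ex_sum. Qed.

Lemma Ex_bigsum (R : realType) (J Z I : finType) (mu : J -> Z -> R)
    (F : I -> {ffun J -> Z} -> R) :
  Ex mu (fun X => \sum_i F i X) = \sum_i Ex mu (F i).
Proof. by rewrite /Ex; under eq_bigr do rewrite mulr_sumr; rewrite exchange_big. Qed.

Lemma ExZr (R : realType) (J Z : finType) (mu : J -> Z -> R) f a :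
  Ex mu (fun X => f X * a) = Ex mu f * a.
Proof. by rewrite /Ex mulr_suml; apply: eq_bigr => X _; rewrite mulrA. Qed.

Lemma prod_by_value (R : comRingType) (J Y : finType) (y : J -> Y) (g : Y -> R) :
  \prod_j g (y j) = \prod_a g a ^+ #|[set j | y j == a]|.
Proof.
rewrite (partition_big y xpredT) //=; apply: eq_bigr => a _.
rewrite (eq_bigr (fun=> g a)); last by move=> j /eqP ->.
by rewrite prodr_const; congr (_ ^+ _); apply: eq_card => j; rewrite inE.
Qed.

Lemma sum_expr_card (R : comRingType) (J Y : finType) (c : Y -> R) :
  (\sum_a c a) ^+ #|J| = \sum_(y : {ffun J -> Y}) \prod_j c (y j).
Proof. by rewrite -(bigA_distr_bigA (fun (_ : J) a => c a)) prodr_const. Qed.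

Lemma even_exprDn (R : realFieldType) (x y : R) n :
  ((x + y) ^+ n + (x - y) ^+ n) / 2
  = \sum_(j < n.+1 | ~~ odd j) 'C(n, j)%:R * x ^+ (n - j) * y ^+ j.
Proof.
rewrite exprDn exprBn -big_split /= mulr_suml [RHS]big_mkcond /=.
apply: eq_bigr => j _; rewrite -signr_odd -[X in X + _]mulr_natr -[X in _ + X]mulr_natr.
by case: (odd j); rewrite /= ?expr0 ?expr1; field.
Qed.

Lemma expR_sum (R : realType) (I : finType) (F : I -> R) :
  expR (\sum_i F i) = \prod_i expR (F i).
Proof. exact: (big_morph _ (@expRD R) (expR0 R)). Qed.

Section ChiSquare.
Variables (R : realType) (Y J : finType) (eta : J -> bool).
Variables (b v kap rho lam : Y -> R).
Hypothesis b_gt0 : forall a, 0 < b a.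
Hypothesis b_sum1 : \sum_a b a = 1.
Hypothesis v_ge0 : forall a, 0 <= v a.
Hypothesis kap01 : forall a, 0 <= kap a <= 1.
Hypothesis rho_le : forall a, 0 <= rho a <= b a.
Hypothesis lam_ge0 : forall a, 0 <= lam a.

(* [kap a] is the probability that element [a] is raised by [v a]. *)
Definition level (a : Y) (o : bool) : R := b a + o%:R * v a.
Definition wt (a : Y) (o : bool) : R := if o then kap a else 1 - kap a.
Definition moment (c : nat) (a : Y) : R := \sum_o wt a o * level a o ^+ c.

(** Lets a single copy perturbed by [lam] dominate two replicas perturbed by [rho]. Only even [j]
    are asked, since random signs cancel the odd powers. *)
Hypothesis moment_lam : forall a c j, ~~ odd j -> (j <= c)%N ->
  moment (c - j) a * (rho a ^+ 2) ^+ j <= moment c a * lam a ^+ j.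

Let m := #|J|.

Definition mass (omega : {ffun Y -> bool}) : R := \sum_a level a (omega a).

(** Normalizing constant of the prior [wt] tilted by the [m]-th power of the mass. *)
Definition tilt_norm : R := Ex wt (fun omega => mass omega ^+ m).

Lemma wt_sum1 a : \sum_o wt a o = 1.
Proof. by rewrite sum_bool /wt subrK. Qed.

Lemma wt_ge0 a o : 0 <= wt a o.
Proof. by rewrite /wt; case/andP: (kap01 a) => h0 h1; case: o => //; lra. Qed.

Lemma level_ge a o : b a <= level a o.
Proof. by rewrite /level lerDl mulr_ge0. Qed.

Lemma level_gt0 a o : 0 < level a o.
Proof. exact: lt_le_trans (b_gt0 a) (level_ge a o). Qed.

Lemma mass_ge1 omega : 1 <= mass omega.
Proof. by rewrite -b_sum1; apply: ler_sum => a _; apply: level_ge. Qed.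

Lemma moment_ge0 c a : 0 <= moment c a.
Proof.
by apply: sumr_ge0 => o _; rewrite mulr_ge0 ?wt_ge0 // exprn_ge0 // ltW // level_gt0.
Qed.

Lemma tilt_norm_gt0 : 0 < tilt_norm.
Proof.
apply: lt_le_trans ltr01 _; rewrite -[leLHS](Ex_cst wt_sum1).
by apply: (le_Ex wt_ge0) => omega; rewrite exprn_ege1 // mass_ge1.
Qed.

Definition pw (a : Y) (p : bool * bool) : R := wt a p.1 * coin R a p.2.

(** Averaging over the signs leaves the even powers on both sides. The [j]-th terms share the factor
    ['C(c, j) * moment (c - j) a], and [moment_lam] compares what remains. *)
Lemma one_coordinate c a :
  \sum_p pw a p * (\sum_p' pw a p' *
    (level a p.1 * level a p'.1 + rho a ^+ 2 * (sgb R p.2 * sgb R p'.2)) ^+ c)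
  <= moment c a * \sum_p pw a p * (level a p.1 + lam a * sgb R p.2) ^+ c.
Proof.
have sum2 (G : bool * bool -> R) : \sum_p pw a p * G p =
    \sum_o wt a o * ((G (o, false) + G (o, true)) / 2).
  rewrite sum_pair; apply: eq_bigr => o _; rewrite /pw /coin /=; by field.
rewrite !sum2.
have -> : moment c a * (\sum_o wt a o * (((level a o + lam a * sgb R false) ^+ c
      + (level a o + lam a * sgb R true) ^+ c) / 2))
    = \sum_(j < c.+1 | ~~ odd j) 'C(c, j)%:R * moment (c - j) a
        * (moment c a * lam a ^+ j).
  under eq_bigr do rewrite /sgb expr0 expr1 mulr1 mulrN1 even_exprDn mulr_sumr.
  rewrite exchange_big mulr_sumr; apply: eq_bigr => j _ /=.
  rewrite /moment !mulr_sumr mulr_suml; apply: eq_bigr => o _; ring.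
have -> : \sum_o wt a o *
   ((\sum_p' pw a p' *
    (level a o * level a p'.1 + rho a ^+ 2 * (sgb R false * sgb R p'.2)) ^+ c +
    \sum_p' pw a p' *
    (level a o * level a p'.1 + rho a ^+ 2 * (sgb R true * sgb R p'.2)) ^+ c) / 2)
   = \sum_(j < c.+1 | ~~ odd j) 'C(c, j)%:R * moment (c - j) a
        * (moment (c - j) a * (rho a ^+ 2) ^+ j).
  transitivity (\sum_o \sum_o' wt a o * (wt a o' *
     (\sum_(j < c.+1 | ~~ odd j)
        'C(c, j)%:R * (level a o * level a o') ^+ (c - j) * (rho a ^+ 2) ^+ j))).
    apply: eq_bigr => o _; rewrite !sum2 /= -mulr_sumr; congr (_ * _).
    rewrite -big_split /= mulr_suml; apply: eq_bigr => o' _.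
    rewrite -even_exprDn /sgb expr0 expr1 !(mulr1, mulrN1, opprK).
    by field.
  under eq_bigr => o _.
    under eq_bigr => o' _ do rewrite !mulr_sumr.
    rewrite exchange_big /=; over.
  rewrite exchange_big /=; apply: eq_bigr => j _.
  transitivity ('C(c, j)%:R * (rho a ^+ 2) ^+ j
      * (moment (c - j) a * moment (c - j) a)); last by ring.
  rewrite /moment big_distrlr /= mulr_sumr; apply: eq_bigr => o _.
  by rewrite mulr_sumr; apply: eq_bigr => o' _; rewrite exprMn; ring.
apply: ler_sum => j /moment_lam h.
by rewrite ler_wpM2l ?mulr_ge0 ?moment_ge0 // h // -ltnS.
Qed.

(** This likelihood and [alt_lik] are unnormalized: the powers of the mass are left to the tilt, and
    the factor 1/2 of each sample sign to [coin]. *)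
Definition null_lik (y : {ffun J -> Y}) : R :=
  Ex wt (fun omega => \prod_j level (y j) (omega (y j))).

Definition alt_lik (y : {ffun J -> Y}) (s : {ffun J -> bool}) : R :=
  Ex wt (fun omega => Ex (coin R) (fun sigma : {ffun Y -> bool} =>
    \prod_j (level (y j) (omega (y j))
             + sgb R (eta j) * (rho (y j) * sgb R (sigma (y j))) * sgb R (s j)))).

(** A comparison quantity: its perturbation is a function of the element alone, so that its sum over
    [y] is the mean of an explicit [m]-th power. *)
Definition ref_lik (y : {ffun J -> Y}) : R :=
  Ex wt (fun omega => Ex (coin R) (fun sigma : {ffun Y -> bool} =>
    \prod_j (level (y j) (omega (y j)) + lam (y j) * sgb R (sigma (y j))))).

Lemma null_lik_gt0 y : 0 < null_lik y.
Proof.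
apply: (@lt_le_trans _ _ (\prod_j b (y j))); first by apply: prodr_gt0.
rewrite -[leLHS](Ex_cst wt_sum1).
apply: (le_Ex wt_ge0) => omega; apply: ler_prod => j _.
by rewrite ltW //= level_ge.
Qed.

(** The square is expanded over two replicas of the hidden [omega] and [sigma]. Averaging over the
    sample signs removes the linear terms; grouping samples by element then gives a product to which
    [one_coordinate] applies factor by factor. *)
Lemma second_moment_le y :
  Ex (coin R) (fun s => alt_lik y s ^+ 2) <= null_lik y * ref_lik y.
Proof.
pose cnt a := #|[set j | y j == a]|.
pose A (u : {ffun Y -> bool * bool}) j (s : bool) : R := level (y j) (u (y j)).1
  + sgb R (eta j) * (rho (y j) * sgb R (u (y j)).2) * sgb R s.
have altE s : alt_lik y s = Ex pw (fun u => \prod_j A u j (s j)).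
  rewrite Ex_pair; apply: eq_Ex => omega; apply: eq_Ex => sigma.
  by apply: eq_bigr => j _; rewrite /A ffunE.
have -> : Ex (coin R) (fun s => alt_lik y s ^+ 2)
    = Ex pw (fun u => Ex pw (fun u' =>
        \prod_j (level (y j) (u (y j)).1 * level (y j) (u' (y j)).1
          + rho (y j) ^+ 2 * (sgb R (u (y j)).2 * sgb R (u' (y j)).2)))).
  transitivity (Ex (coin R) (fun s => \sum_(u : {ffun Y -> bool * bool})
     (\prod_a pw a (u a)) * Ex pw (fun u' => \prod_j (A u j (s j) * A u' j (s j))))).
    apply: eq_Ex => s; rewrite altE expr2 {1}/Ex mulr_suml.
    apply: eq_bigr => u _; rewrite -mulrA -ExZ; congr (_ * _).
    by apply: eq_Ex => u'; rewrite big_split.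
  rewrite Ex_sum; apply: eq_bigr => u _; congr (_ * _).
  rewrite {2}/Ex Ex_sum; apply: eq_bigr => u' _; congr (_ * _).
  rewrite (Ex_prod _ (fun j s => A u j s * A u' j s)).
  apply: eq_bigr => j _; rewrite sum_bool /coin /A.
  move: (sgbK R (eta j)); rewrite /sgb /= expr0 expr1.
  set e := (-1) ^+ eta j => ee.
  transitivity (level (y j) (u (y j)).1 * level (y j) (u' (y j)).1
    + rho (y j) ^+ 2 * (e * e) * ((-1) ^+ (u (y j)).2 * (-1) ^+ (u' (y j)).2)).
    by field.
  by rewrite ee mulr1.
pose g a (p p' : bool * bool) := level a p.1 * level a p'.1
  + rho a ^+ 2 * (sgb R p.2 * sgb R p'.2).
have -> : Ex pw (fun u => Ex pw (fun u' => \prod_j g (y j) (u (y j)) (u' (y j))))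
    = \prod_a \sum_p pw a p * (\sum_p' pw a p' * g a p p' ^+ cnt a).
  rewrite -Ex_prod; apply: eq_Ex => u; rewrite -Ex_prod; apply: eq_Ex => u'.
  by rewrite (prod_by_value y (fun a => g a (u a) (u' a))).
have -> : null_lik y = \prod_a moment (cnt a) a.
  rewrite -Ex_prod; apply: eq_Ex => omega.
  by rewrite (prod_by_value y (fun a => level a (omega a))).
have -> : ref_lik y
    = \prod_a \sum_p pw a p * (level a p.1 + lam a * sgb R p.2) ^+ cnt a.
  rewrite -Ex_prod Ex_pair; apply: eq_Ex => omega; apply: eq_Ex => sigma.
  rewrite (prod_by_value y (fun a => level a (omega a) + lam a * sgb R (sigma a))).
  by apply: eq_bigr => a _; rewrite ffunE.
rewrite -big_split /=; apply: ler_prod => a _; rewrite one_coordinate andbT.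
(* Comparing products factor by factor needs nonnegative factors: [rho ^ 2] is at most the product
   of any two levels. *)
have pw0 p : 0 <= pw a p by rewrite mulr_ge0 ?wt_ge0 ?coin_ge0.
apply: sumr_ge0 => p _; rewrite mulr_ge0 //; apply: sumr_ge0 => p' _.
rewrite mulr_ge0 // exprn_ge0 // /g.
have /andP[r0 rb] := rho_le a.
have h : rho a ^+ 2 <= level a p.1 * level a p'.1.
  by rewrite expr2 ler_pM // (le_trans rb) // level_ge.
have : `|rho a ^+ 2 * (sgb R p.2 * sgb R p'.2)| <= rho a ^+ 2.
  by rewrite !normrM !normr_sgb !mulr1 ger0_norm ?sqr_ge0.
by rewrite ler_norml => /andP[h1 _]; lra.
Qed.

Lemma sum_null_lik : \sum_y null_lik y = tilt_norm.
Proof.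
rewrite /null_lik /tilt_norm /mass /Ex exchange_big; apply: eq_bigr => omega _ /=.
by rewrite -mulr_sumr sum_expr_card.
Qed.

Lemma sum_ref_lik : \sum_y ref_lik y
  = Ex wt (fun omega => Ex (coin R) (fun sigma : {ffun Y -> bool} =>
      (mass omega + \sum_a lam a * sgb R (sigma a)) ^+ m)).
Proof.
rewrite /ref_lik {1}/Ex exchange_big; apply: eq_bigr => omega _ /=.
rewrite -mulr_sumr; congr (_ * _); rewrite {1}/Ex exchange_big.
apply: eq_bigr => sigma _ /=; rewrite -mulr_sumr; congr (_ * _).
by rewrite -big_split /= sum_expr_card.
Qed.

Lemma Ex_coin_alt_lik y : Ex (coin R) (alt_lik y) = null_lik y.
Proof.
rewrite Ex_exchange; apply: eq_Ex => omega.
rewrite Ex_exchange -[RHS](Ex_cst (@coin_sum1 R Y)); apply: eq_Ex => sigma.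
rewrite (Ex_prod _ (fun j s => level (y j) (omega (y j))
   + sgb R (eta j) * (rho (y j) * sgb R (sigma (y j))) * sgb R s)).
apply: eq_bigr => j _; rewrite sum_bool /coin /sgb expr0 expr1; by field.
Qed.

(** Cauchy-Schwarz linearized with a free [tau]: for [d = M - alt],
    [d f <= tau M f^2 / 2 + d^2 / (2 tau M)]. As [alt_lik] has mean [M], the chi-square part is
    controlled by [second_moment_le]. *)
Lemma chi_square_bound (f : {ffun J -> Y} -> {ffun J -> bool} -> R) (tau : R) :
  0 < tau -> (forall y s, 0 <= f y s <= 1) ->
  \sum_y Ex (coin R) (fun s => (null_lik y - alt_lik y s) * f y s)
  <= tau / 2 * tilt_norm + (2 * tau)^-1 *
   (Ex wt (fun omega => Ex (coin R) (fun sigma : {ffun Y -> bool} =>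
      (mass omega + \sum_a lam a * sgb R (sigma a)) ^+ m)) - tilt_norm).
Proof.
move=> tau0 f01; rewrite -sum_ref_lik -sum_null_lik -sumrB !mulr_sumr -big_split /=.
apply: ler_sum => y _; have M0 := null_lik_gt0 y.
set M := null_lik y in M0 *.
have t2 : 0 < (2 * tau)^-1 by rewrite invr_gt0; lra.
apply: (@le_trans _ _ (Ex (coin R) (fun s => tau / 2 * M
    + (2 * tau)^-1 * (M^-1 * (alt_lik y s ^+ 2) - 2 * alt_lik y s + M)))).
  apply: (le_Ex (@coin_ge0 R J)) => s; have /andP[f0 f1] := f01 y s.
  set d := M - alt_lik y s; set g := f y s in f0 f1 *.
  have -> : M^-1 * alt_lik y s ^+ 2 - 2 * alt_lik y s + M = d ^+ 2 / M.
    by rewrite /d; field; lra.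
  have h1 : tau / 2 * (M * g ^+ 2) <= tau / 2 * M.
    by rewrite ler_wpM2l //; [lra|rewrite ler_piMr ?expr_le1 // ltW].
  apply: le_trans (lerD h1 (lexx _)).
  have : 0 <= (2 * tau * M)^-1 * (d - tau * M * g) ^+ 2.
    by rewrite mulr_ge0 ?sqr_ge0 // invr_ge0 !mulr_ge0 // ltW.
  have -> : (2 * tau * M)^-1 * (d - tau * M * g) ^+ 2
      = tau / 2 * (M * g ^+ 2) + (2 * tau)^-1 * (d ^+ 2 / M) - d * g.
    by field; lra.
  lra.
rewrite ExD (Ex_cst (@coin_sum1 R J)) lerD2l ExZ ler_wpM2l ?(ltW t2) //.
rewrite ExD ExB !ExZ (Ex_cst (@coin_sum1 R J)) Ex_coin_alt_lik -/M.
have := second_moment_le y; rewrite -/M -ler_pdivrMl // => h; lra.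
Qed.

Lemma cosh_le (x : R) : `|x| <= 1 / 2 ->
  (expR x + expR (- x)) / 2 <= expR (2 * x ^+ 2).
Proof.
rewrite ler_norml => /andP[h1 h2].
have e1 := expR_le_quad h2.
have e2 : expR (- x) <= 1 + - x + 2 * (- x) ^+ 2 by apply: expR_le_quad; lra.
rewrite sqrrN in e2.
have := expR_ge1Dx (2 * x ^+ 2); lra.
Qed.

(** After factoring out [W ^ m], [1 + x / W <= expR (x / W)] turns the power into a product over
    independent signs, each averaged by [cosh_le]. *)
Lemma ref_moment_le : \sum_a lam a <= 1 -> (forall a, m%:R * lam a <= 1 / 2) ->
  Ex wt (fun omega => Ex (coin R) (fun sigma : {ffun Y -> bool} =>
      (mass omega + \sum_a lam a * sgb R (sigma a)) ^+ m))
  <= expR (\sum_a 2 * (m%:R * lam a) ^+ 2) * tilt_norm.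
Proof.
move=> lam1 mlam; rewrite -ExZ; apply: (le_Ex wt_ge0) => omega.
have W1 := mass_ge1 omega; set W := mass omega in W1 *.
have W0 : 0 < W by lra.
pose q a := m%:R * lam a / W.
have q0 a : 0 <= q a by rewrite divr_ge0 ?mulr_ge0 // ltW.
have q_le a : q a <= m%:R * lam a.
  by rewrite ler_pdivrMr // ler_peMr // mulr_ge0.
apply: (@le_trans _ _ (Ex (coin R) (fun sigma : {ffun Y -> bool} =>
    W ^+ m * \prod_a expR (q a * sgb R (sigma a))))).
  apply: (le_Ex (@coin_ge0 R Y)) => sigma; set x := \sum_a _.
  (* Keeps [1 + x / W] nonnegative, so that the comparison survives the [m]-th power. *)
  have hx : - 1 <= x.
    have : `|x| <= 1.
      apply: le_trans lam1; apply: le_trans (ler_norm_sum _ _ _) _.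
      by apply: ler_sum => a _; rewrite normrM normr_sgb mulr1 ger0_norm.
    by rewrite ler_norml => /andP[].
  have -> : W + x = W * (1 + x / W) by field; lra.
  rewrite exprMn ler_wpM2l ?exprn_ge0 ?(ltW W0) //.
  have -> : \prod_a expR (q a * sgb R (sigma a)) = expR (x / W) ^+ m.
    rewrite -expR_sum -expRM_natl; congr expR.
    rewrite /x mulr_suml mulr_sumr; apply: eq_bigr => a _; rewrite /q; ring.
  rewrite lerXn2r ?nnegrE ?expR_ge0 ?expR_ge1Dx //.
  have : - 1 <= x / W by rewrite ler_pdivlMr //; lra.
  lra.
rewrite ExZ mulrC ler_wpM2r ?exprn_ge0 ?(ltW W0) //.
rewrite (Ex_prod _ (fun a s => expR (q a * sgb R s))) expR_sum.
apply: ler_prod => a _; rewrite sum_bool /coin /sgb expr0 expr1 mulr1 mulrN1.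
have -> : 1 / 2 * expR (q a) + 1 / 2 * expR (- q a)
  = (expR (q a) + expR (- q a)) / 2 by field.
rewrite divr_ge0 ?addr_ge0 ?expR_ge0 //=.
apply: le_trans (cosh_le _) _.
  by rewrite ger0_norm // (le_trans (q_le a)).
by rewrite ler_expR ler_wpM2l // lerXn2r ?nnegrE // (le_trans (q0 a)).
Qed.

(** As the mass is at least 1, raising [a] multiplies it by at most [1 + v a]; the tilt inflates the
    probability of a raise by at most [(1 + v a) ^ m]. *)
Lemma tilt_coordinate a :
  Ex wt (fun omega => (omega a)%:R * mass omega ^+ m)
  <= kap a * (1 + v a) ^+ m * tilt_norm.
Proof.
rewrite (Ex_resample (i := a)) ?wt_sum1 // -ExZ; apply: (le_Ex wt_ge0) => omega.
have /andP[k0 k1] := kap01 a.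
rewrite sum_bool !updE mul0r mulr0 add0r mul1r -mulrA ler_wpM2l //.
have W1 := mass_ge1 omega; have va := v_ge0 a.
rewrite -exprMn lerXn2r ?nnegrE //.
- by apply: (le_trans ler01); apply: mass_ge1.
- by rewrite mulr_ge0 ?addr_ge0 // (le_trans ler01).
have : mass (upd omega a true) <= mass omega + v a.
  rewrite /mass (bigD1 a) //= [X in _ <= X + _](bigD1 a) //= updE.
  rewrite (eq_bigr (fun i => level i (omega i))); last first.
    by move=> i ia; rewrite upd_neq.
  rewrite [leRHS]addrAC lerD2r; apply: (@le_trans _ _ (b a + v a)).
    by rewrite /level mul1r.
  by rewrite lerD2r level_ge.
nra.
Qed.

(** [mass omega - 1] is the total raise, so its tilted mean is a sum of [tilt_coordinate] bounds. *)
Lemma tilt_mean (c : R) : (forall a, (1 + v a) ^+ m <= c) ->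
  Ex wt (fun omega => (mass omega - 1) * mass omega ^+ m)
  <= c * (\sum_a v a * kap a) * tilt_norm.
Proof.
move=> hc; rewrite (eq_Ex (fun omega : {ffun Y -> bool} =>
   \sum_a v a * ((omega a)%:R * mass omega ^+ m))); last first.
  move=> omega; rewrite /mass big_split /= b_sum1 addrAC subrr add0r mulr_suml.
  by apply: eq_bigr => a _; rewrite mulrA (mulrC (v a)).
rewrite Ex_sum mulr_sumr mulr_suml; apply: ler_sum => a _.
have /andP[k0 k1] := kap01 a; have va := v_ge0 a; have Z0 := tilt_norm_gt0.
apply: (@le_trans _ _ (v a * (kap a * (1 + v a) ^+ m * tilt_norm))).
  by rewrite ler_wpM2l // tilt_coordinate.
have : v a * kap a * tilt_norm * (1 + v a) ^+ m <= v a * kap a * tilt_norm * c.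
  by rewrite ler_wpM2l // !mulr_ge0 // ltW.
lra.
Qed.

Definition sample_dens (omega : {ffun Y -> bool}) (u : Y -> R) (e : bool) :
  Y * bool -> R :=
  sdens (fun a => level a (omega a) / mass omega)
        (fun a => sgb R e * (u a / mass omega)).

(** Each of the [m] densities carries one factor [1 / mass], which the tilt cancels. *)
Lemma sample_lik omega u (f : {ffun J -> Y * bool} -> R) :
  mass omega ^+ m * Ex (fun j => sample_dens omega u (eta j)) f
  = \sum_(y : {ffun J -> Y}) Ex (coin R) (fun s : {ffun J -> bool} =>
      \prod_j (level (y j) (omega (y j)) + sgb R (eta j) * u (y j) * sgb R (s j))
      * f [ffun j => (y j, s j)]).
Proof.
have W0 : mass omega != 0 by rewrite gt_eqF // (lt_le_trans ltr01) // mass_ge1.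
rewrite /Ex sum_ffun_pair mulr_sumr; apply: eq_bigr => y _.
rewrite mulr_sumr; apply: eq_bigr => s _.
rewrite !mulrA; congr (_ * _); rewrite -prodr_const -!big_split /=.
apply: eq_bigr => j _; rewrite ffunE /sample_dens /sdens /coin /=.
by field.
Qed.

(* The weight [mass omega ^+ m] is the tilt of the prior on [omega]. *)
Lemma tilted_gap (f : {ffun J -> Y * bool} -> R) tau : 0 < tau ->
  (forall X, 0 <= f X <= 1) ->
  \sum_a lam a <= 1 -> (forall a, m%:R * lam a <= 1 / 2) ->
  Ex wt (fun omega => mass omega ^+ m *
    (Ex (fun j => sample_dens omega (fun=> 0) (eta j)) f
     - Ex (coin R) (fun sigma : {ffun Y -> bool} =>
         Ex (fun j => sample_dens omega (fun a => rho a * sgb R (sigma a)) (eta j)) f)))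
  <= (tau / 2 + (2 * tau)^-1 * (expR (\sum_a 2 * (m%:R * lam a) ^+ 2) - 1))
     * tilt_norm.
Proof.
move=> tau0 f01 lam1 mlam.
have := chi_square_bound (f := fun (y : {ffun J -> Y}) (s : {ffun J -> bool}) =>
  f [ffun j => (y j, s j)]) tau0 (fun y s => f01 _).
set L := (X in X <= _) => hL.
have t2 : 0 < (2 * tau)^-1 by rewrite invr_gt0; lra.
have := ref_moment_le lam1 mlam; rewrite -(ler_pM2l t2) => hE.
(* [G] and [L] are the same average, over [omega], [sigma] and the samples, taken in different
   orders. *)
set G := (X in X <= _); suff : G = L by lra.
rewrite /G /L.
transitivity (\sum_(y : {ffun J -> Y}) Ex (coin R)
    (fun s : {ffun J -> bool} => Ex wt (fun omega =>
    \prod_j level (y j) (omega (y j)) * f [ffun j => (y j, s j)]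
  - Ex (coin R) (fun sigma : {ffun Y -> bool} =>
      \prod_j (level (y j) (omega (y j))
             + sgb R (eta j) * (rho (y j) * sgb R (sigma (y j))) * sgb R (s j))
       * f [ffun j => (y j, s j)])))); last first.
  apply: eq_bigr => y _; apply: eq_Ex => s; rewrite ExB ExZr mulrBl.
  by congr (_ - _); rewrite -ExZr; apply: eq_Ex => omega; rewrite ExZr.
under [RHS]eq_bigr do rewrite Ex_exchange.
rewrite -Ex_bigsum; apply: eq_Ex => omega; rewrite mulrBr sample_lik.
under [RHS]eq_bigr do rewrite ExB.
rewrite sumrB; congr (_ - _).
  apply: eq_bigr => y _; apply: eq_Ex => s; congr (_ * _).
  by apply: eq_bigr => j _; rewrite mulr0 mul0r addr0.
under [RHS]eq_bigr do rewrite Ex_exchange.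
by rewrite -Ex_bigsum -ExZ; apply: eq_Ex => sigma; rewrite sample_lik.
Qed.

End ChiSquare.

(** * Consequences for testers *)

Lemma embedding (Z : finType) n : (#|Z| <= n)%N -> {f : Z -> 'I_n | injective f}.
Proof.
move=> h; exists (fun z => widen_ord h (enum_rank z)) => x y /(congr1 (@nat_of_ord n)) /= e.
by apply: enum_rank_inj; apply: ord_inj.
Qed.

Section TesterBounds.
Variables (R : realType) (n sp sq : nat) (eps alpha xi : R).
Variable A : algorithm R n sp sq.
Hypothesis eps_gt0 : 0 < eps.
Hypothesis alpha_gt0 : 0 < alpha.
Hypothesis xi_ge0 : 0 <= xi.
Hypothesis A_dp : differentially_private xi A.
Hypothesis A_test : augmented_closeness_tester eps alpha (2 / 10) A.

Notation J := ('I_sp + 'I_sq)%type.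

Definition side (j : J) : bool := if j is inl _ then false else true.

Let m : R := (sp + sq)%:R.

Lemma card_samples : #|{: J}|%:R = m.
Proof. by rewrite card_sum !card_ord. Qed.

Section Embedded.
Variables (Y : finType) (iota : Y * bool -> 'I_n).
Hypothesis iota_inj : injective iota.

(** For each fixed sign pattern, [dTV_signed] puts the pair beyond [eps], whatever the advice. *)
Lemma far_accept phat (pi r : Y -> R) (sigma : Y -> bool) :
  (forall y, 0 <= r y <= pi y) -> \sum_y pi y = 1 -> eps < \sum_y r y ->
  Ex (fun j : J => sdens pi (fun y => sgb R (side j) * (r y * sgb R (sigma y))))
     (pull iota A phat Accept) <= 2 / 10.
Proof.
move=> r_le pi1 far.
have r0 y : 0 <= r y by case/andP: (r_le y).
have ru y : `|r y * sgb R (sigma y)| <= pi y.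
  by rewrite normrM normr_sgb mulr1 ger0_norm //; case/andP: (r_le y).
have [p hp] : exists p, is_push iota (sdens pi (fun y => r y * sgb R (sigma y))) p.
  by apply: push_exists => [z|]; rewrite ?sum_sdens //; apply: sdens_ge0.
have [q hq] : exists q, is_push iota (sdens pi (fun y => - (r y * sgb R (sigma y)))) q.
  apply: push_exists => [z|]; rewrite ?sum_sdens //; apply: sdens_ge0.
  by rewrite normrN.
have [_ h _] := A_test phat p q.
have := h (lt_le_trans far (dTV_signed iota_inj r0 hp hq)).
rewrite (output_prob_push _ _ _ hp hq); apply: le_trans.
rewrite le_eqVlt; apply/orP; left; apply/eqP; apply: eq_Ex_dens => -[j|j] z.
  by rewrite /sdens /= /sgb expr0 mul1r.
by rewrite /sdens /= /sgb expr1 mulN1r.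
Qed.

(** The excess [e] of [pi] over the advice bounds their distance; [6/10] is [1 - 2 * 0.2]. *)
Lemma near_accept phat (pi base e : Y -> R) :
  is_push iota (sdens base (fun=> 0)) phat ->
  (forall y, 0 <= pi y) -> \sum_y pi y = 1 -> (forall y, 0 <= e y) ->
  (forall y, pi y <= base y + e y) -> \sum_y e y <= alpha ->
  6 / 10 <= Ex (fun j : J => sdens pi (fun y => sgb R (side j) * 0))
     (pull iota A phat Accept).
Proof.
move=> hphat pi0 pi1 e0 pi_le e_le.
have [p hp] : exists p, is_push iota (sdens pi (fun y => 0)) p.
  apply: push_exists => [z|]; rewrite ?sum_sdens //; apply: sdens_ge0.
  by rewrite normr0.
have near : dTV p phat <= alpha.
  apply: (dTV_push_le hp hphat (e := sdens e (fun=> 0))); first exact: ltW.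
  - by move=> z; apply: sdens_ge0; rewrite normr0.
  - by rewrite sum_sdens.
  - by move=> z; rewrite /sdens; have := pi_le z.1; lra.
have := null_accept A_test near; rewrite (output_prob_push _ _ _ hp hp) => h.
apply: (@le_trans _ _ (1 - 2 * (2 / 10))); first lra.
apply: (le_trans h); rewrite le_eqVlt; apply/orP; left; apply/eqP.
by apply: eq_Ex_dens => j z; rewrite /sdens mulr0; case: j.
Qed.

End Embedded.

(** * Lower bounds from privacy *)

Section Privacy.
Variables (Y : finType) (theta : R).
Hypothesis Y_gt0 : (0 < #|Y|)%N.
Hypothesis Y_le : (2 * #|Y| <= n)%N.
Hypothesis theta_eps : eps < theta.
Hypothesis theta_le1 : theta <= 1.

Notation k := (#|Y|%:R : R).

Let iota_sig : {f : Y * bool -> 'I_n | injective f}.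
Proof. by apply: embedding; rewrite card_prod card_bool mulnC. Qed.

Let k_gt0 : 0 < k. Proof. by rewrite ltr0n. Qed.

Let sum_k a : \sum_(y : Y) (a / k) = a.
Proof. by rewrite sumr_const -[LHS]mulr_natr mulfVK // gt_eqF. Qed.

Let theta01 : 0 <= theta <= 1.
Proof. by rewrite theta_le1 andbT ltW // (lt_trans eps_gt0). Qed.

(** The advice is the null distribution itself, at distance 0, so [alpha] does not enter the privacy
    terms. *)
Let uniform_advice (iota : Y * bool -> 'I_n) : injective iota ->
  exists2 phat, 6 / 10 <= Ex (pert side (fun=> 0)) (pull iota A phat Accept) &
   forall sigma, Ex (pert side (fun y => theta / k * sgb R (sigma y)))
                    (pull iota A phat Accept) <= 2 / 10.
Proof.
move=> inj; have k0 : 0 <= k^-1 by rewrite invr_ge0 ltW.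
have s1 : \sum_(y : Y) k^-1 = 1 by rewrite -[RHS]sum_k; under [RHS]eq_bigr do rewrite mul1r.
have [phat hphat] : exists phat, is_push iota (sdens (fun=> k^-1) (fun=> 0)) phat.
  apply: push_exists => [z|]; rewrite ?sum_sdens //; apply: sdens_ge0.
  by rewrite normr0.
exists phat.
  apply: (near_accept hphat (e := fun=> 0)) => // [y|]; first by rewrite addr0.
  by rewrite big1_eq ltW.
move=> sigma; apply: (@far_accept _ _ inj phat (fun=> k^-1) (fun=> theta / k) sigma) => // [y|].
  by case/andP: theta01 => t0 t1; rewrite mulr_ge0 //= ler_piMl.
by rewrite sum_k.
Qed.

Lemma privacy_linear : 4 / 10 <= m * (theta * (xi / 2)).
Proof.
case: iota_sig => iota inj; have [phat h0 h1] := uniform_advice inj.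
have lip X j z z' := dp_lipschitz iota phat Accept X j z z' xi_ge0 A_dp.
have := fixed_signs side Y_gt0 theta01 lip.
rewrite card_samples ler_norml => /andP[h _]; have := h1 (fun=> false).
rewrite (eq_Ex_dens (nu := pert side (fun=> theta / k))); last first.
  by move=> j z; rewrite /pert /sdens /sgb expr0 mulr1.
lra.
Qed.

(** Acceptance is at most [2/10] for every sign pattern, hence on average, while the null pair is
    accepted with probability at least [6/10]. *)
Lemma privacy_quadratic (D : R) :
  m * (theta / k) <= D \/ 0 < D /\ m * (theta ^+ 2 / k) <= (D / 2) ^+ 2 ->
  4 / 10 <= m * theta * xi * D / 2.
Proof.
rewrite -card_samples => hD.
case: iota_sig => iota inj; have [phat h0 h1] := uniform_advice inj.
have lip X j z z' := dp_lipschitz iota phat Accept X j z z' xi_ge0 A_dp.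
have := random_signs side Y_gt0 theta01 xi_ge0 lip hD.
rewrite ler_norml => /andP[h _].
have : Ex (coin R) (fun sigma : {ffun Y -> bool} =>
    Ex (pert side (fun y => theta / k * sgb R (sigma y))) (pull iota A phat Accept))
    <= 2 / 10.
  rewrite -[leRHS](Ex_cst (@coin_sum1 R Y)); apply: (le_Ex (@coin_ge0 R Y)) => sigma.
  exact: h1.
lra.
Qed.

End Privacy.

(** * Lower bound from the chi-square divergence *)

Section ChiSquareTester.
Variables (Y : finType) (b v kap rho lam : Y -> R) (beta c : R).
Hypothesis Y_le : (2 * #|Y| <= n)%N.
Hypothesis b_gt0 : forall a, 0 < b a.
Hypothesis b_sum1 : \sum_a b a = 1.
Hypothesis v_ge0 : forall a, 0 <= v a.
Hypothesis kap01 : forall a, 0 <= kap a <= 1.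
Hypothesis rho_le : forall a, 0 <= rho a <= b a.
Hypothesis lam_ge0 : forall a, 0 <= lam a.
Hypothesis moment_lam : forall a i j, ~~ odd j -> (j <= i)%N ->
  moment b v kap (i - j) a * (rho a ^+ 2) ^+ j <= moment b v kap i a * lam a ^+ j.
Hypothesis beta_gt0 : 0 < beta.
Hypothesis beta_le : beta <= alpha.
Hypothesis rho_far : eps * (1 + beta) < \sum_a rho a.
Hypothesis v_pow : forall a, (1 + v a) ^+ (sp + sq) <= c.
Hypothesis v_mean : c * (\sum_a v a * kap a) <= beta / 20.
Hypothesis lam_sum : \sum_a lam a <= 1.
Hypothesis lam_le : forall a, m * lam a <= 1 / 2.

(** Otherwise the divergence is too small for the acceptance gap that a tester must have under the
    tilted prior. *)
Lemma chi_square_tester : 1 / 20 < \sum_a 2 * (m * lam a) ^+ 2.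
Proof.
rewrite ltNge; apply/negP => S_le; set S := \sum_a _ in S_le.
have cardJ : #|{: J}| = (sp + sq)%N by rewrite card_sum !card_ord.
have [iota inj] : {f : Y * bool -> 'I_n | injective f}.
  by apply: embedding; rewrite card_prod card_bool mulnC.
have [phat hphat] : exists phat, is_push iota (sdens b (fun=> 0)) phat.
  apply: push_exists => [z|]; rewrite ?sum_sdens //; apply: sdens_ge0.
  by rewrite normr0 ltW.
pose f := pull iota A phat Accept.
have f01 X : 0 <= f X <= 1 by rewrite /f /pull pmf_ge0 pmf_le1.
pose W := mass b v; pose Zc := tilt_norm J b v kap.
have Zc0 : 0 < Zc by apply: tilt_norm_gt0.
have W1 omega : 1 <= W omega by apply: mass_ge1.
have W0 omega : 0 < W omega by apply: lt_le_trans (W1 omega).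
have mJ : #|{: J}|%:R = m := card_samples.
(* With [S <= 1/20] this choice of [tau] bounds the gap by less than [1/4], against the [33/100] of
   [low]. *)
have tau0 : 0 < 3 / 10 :> R by lra.
have := tilted_gap side b_gt0 b_sum1 v_ge0 kap01 rho_le lam_ge0
  moment_lam tau0 f01 lam_sum.
rewrite mJ cardJ => /(_ lam_le); rewrite -/S -/Zc -/W.
have mean : Ex (wt kap) (fun omega => (W omega - 1) * W omega ^+ (sp + sq))
    <= beta / 20 * Zc.
  have := tilt_mean (J := J) b_sum1 v_ge0 kap01 (c := c).
  rewrite cardJ => /(_ v_pow) h; apply: (le_trans h).
  by apply: ler_wpM2r v_mean; exact: ltW.
(* [14/10] is [4/10 + 1]: once the raise exceeds [beta] the left side is below the trivial bound
   [-1]. *)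
have gap omega : 4 / 10 - 14 / 10 / beta * (W omega - 1)
  <= Ex (fun j : J => sample_dens b v omega (fun=> 0) (side j)) f
   - Ex (coin R) (fun sigma : {ffun Y -> bool} =>
       Ex (fun j : J => sample_dens b v omega (fun a => rho a * sgb R (sigma a)) (side j)) f).
  have piW y : 0 <= level b v y (omega y) / W omega.
    by rewrite divr_ge0 // ltW // level_gt0.
  have piW1 : \sum_y level b v y (omega y) / W omega = 1.
    by rewrite -mulr_suml -/(mass b v omega) -/(W omega) divff // gt_eqF.
  have bound01 u : (forall y, `|u y| <= level b v y (omega y)) ->
      0 <= Ex (fun j : J => sample_dens b v omega u (side j)) f <= 1.
    move=> hu; have d0 (j : J) z : 0 <= sample_dens b v omega u (side j) z.
      apply: sdens_ge0; rewrite normrM normr_sgb mul1r normrM normfV.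
      by rewrite (gtr0_norm (W0 omega)) ler_pM2r ?invr_gt0.
    have d1 (j : J) : \sum_z sample_dens b v omega u (side j) z = 1.
      by rewrite sum_sdens.
    rewrite -[X in X <= _ <= _](Ex_cst d1) -[X in _ <= _ <= X](Ex_cst d1).
    by rewrite !le_Ex // => X; case/andP: (f01 X).
  set E0 := Ex _ f; set E1 := Ex (coin R) _.
  have E0ge : 0 <= E0.
    have z0 y : `|0 : R| <= level b v y (omega y) by rewrite normr0 ltW // level_gt0.
    by have /andP[] := bound01 (fun=> 0) z0.
  have rho_lev sigma y : `|rho y * sgb R (sigma y)| <= level b v y (omega y).
    have /andP[r0 rb] := rho_le y.
    by rewrite normrM normr_sgb mulr1 ger0_norm // (le_trans rb) // level_ge.
  have E1le : E1 <= 1.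
    rewrite -[leRHS](Ex_cst (@coin_sum1 R Y)); apply: (le_Ex (@coin_ge0 R Y)) => sigma.
    by have /andP[] := bound01 _ (rho_lev sigma).
  (* The tester is only constrained when the raised mass is at most [beta <= alpha];
     Markov's inequality is applied through [1 <= (W omega - 1) / beta]. *)
  have [good|bad] := lerP (W omega - 1) beta; last first.
    have : 1 <= (W omega - 1) / beta by rewrite ler_pdivlMr // mul1r ltW.
    have -> : 14 / 10 / beta * (W omega - 1) = 14 / 10 * ((W omega - 1) / beta) by ring.
    lra.
  have : 0 <= 14 / 10 / beta * (W omega - 1).
    by rewrite mulr_ge0 ?divr_ge0 ?subr_ge0 // ltW.
  suff : 6 / 10 <= E0 /\ E1 <= 2 / 10 by lra.
  split.
    have := @near_accept Y iota phat (fun y => level b v y (omega y) / W omega)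
      b (fun y => (omega y)%:R * v y) hphat piW piW1.
    have e0 y : 0 <= (omega y)%:R * v y by rewrite mulr_ge0.
    move=> /(_ e0) h.
    apply: le_trans (h _ _) _.
    - by move=> y; rewrite ler_pdivrMr // ler_peMr // ltW // level_gt0.
    - apply: le_trans beta_le; apply: le_trans good.
      by rewrite /W /mass big_split /= b_sum1 addrAC subrr add0r.
    rewrite le_eqVlt; apply/orP; left; apply/eqP; apply: eq_Ex_dens => j z.
    by rewrite /sample_dens /sdens mul0r.
  rewrite -[leRHS](Ex_cst (@coin_sum1 R Y)); apply: (le_Ex (@coin_ge0 R Y)) => sigma.
  have := @far_accept Y iota inj phat (fun y => level b v y (omega y) / W omega)
      (fun y => rho y / W omega) sigma _ piW1.
  have rW y : 0 <= rho y / W omega <= level b v y (omega y) / W omega.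
    have /andP[r0 rb] := rho_le y.
    by rewrite divr_ge0 // ?(ltW (W0 _)) //= ler_pM2r ?invr_gt0 // (le_trans rb) // level_ge.
  move=> /(_ rW) h; apply: le_trans (h _).
    rewrite le_eqVlt; apply/orP; left; apply/eqP; apply: eq_Ex_dens => j z.
    rewrite /sample_dens /sdens /= -/(W omega); congr ((_ + _ * _) / _).
    by rewrite mulrAC.
  (* Normalization divides the perturbation by [W omega <= 1 + beta], which [rho_far] allows for. *)
  rewrite -mulr_suml ltr_pdivlMr //; apply: le_lt_trans rho_far.
  by rewrite ler_pM2l //; lra.
(* By [mean], averaging [gap] under the tilt costs [14/10] times [1/20]. *)
have low : (4 / 10 - 7 / 100) * Zc <= Ex (wt kap) (fun omega => W omega ^+ (sp + sq) *
    (Ex (fun j : J => sample_dens b v omega (fun=> 0) (side j)) f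
   - Ex (coin R) (fun sigma : {ffun Y -> bool} =>
       Ex (fun j : J => sample_dens b v omega (fun a => rho a * sgb R (sigma a)) (side j)) f))).
  apply: (@le_trans _ _ (Ex (wt kap) (fun omega => 4 / 10 * W omega ^+ (sp + sq)
     - 14 / 10 / beta * ((W omega - 1) * W omega ^+ (sp + sq))))).
    have ZE : Ex (wt kap) (fun omega => W omega ^+ (sp + sq)) = Zc.
      by rewrite /Zc /tilt_norm cardJ.
    rewrite ExB !ExZ ZE.
    have b0 : 0 <= 14 / 10 / beta by rewrite !divr_ge0 // ltW.
    have := ler_wpM2l b0 mean.
    have -> : 14 / 10 / beta * (beta / 20 * Zc) = 7 / 100 * Zc by field; rewrite gt_eqF.
    lra.
  apply: (le_Ex (wt_ge0 kap01)) => omega.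
  have := ler_wpM2l (exprn_ge0 (sp + sq) (ltW (W0 omega))) (gap omega).
  lra.
move=> /(le_trans low); rewrite ler_pM2r //.
have : expR S <= 1 + S + 2 * S ^+ 2 by apply: expR_le_quad; lra.
have S0 : 0 <= S by apply: sumr_ge0 => a _; rewrite mulr_ge0 ?sqr_ge0.
have -> : (2 * (3 / 10))^-1 = 5 / 3 :> R by field.
nra.
Qed.

End ChiSquareTester.
End TesterBounds.

(** * Moment comparisons at a single element *)

Lemma momentE (R : realType) (Y : finType) (b v kap : Y -> R) c a :
  moment b v kap c a = (1 - kap a) * b a ^+ c + kap a * (b a + v a) ^+ c.
Proof. by rewrite /moment sum_bool /wt /level mul0r addr0 mul1r. Qed.

(** Without a raise the moments are the powers of [b a], and both sides are equal. *)
Lemma moment_lam_const (R : realType) (Y : finType) (b v kap rho lam : Y -> R) a i j :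
  v a = 0 -> rho a ^+ 2 = lam a * b a -> (j <= i)%N ->
  moment b v kap (i - j) a * (rho a ^+ 2) ^+ j <= moment b v kap i a * lam a ^+ j.
Proof.
move=> v0 e ij; rewrite !momentE v0 addr0 e -!mulrDl subrK !mul1r exprMn.
by rewrite mulrCA -exprD subnK // mulrC.
Qed.

(* Here [s = sqrt (kap a)]: its even powers beyond the zeroth are at most [kap a],
   the probability that the element is raised. *)
Lemma moment_lam_heavy (R : realType) (Y : finType) (b v kap rho lam : Y -> R) a i j
    (s : R) : ~~ odd j -> (j <= i)%N ->
  0 <= b a -> 0 <= v a -> 0 <= s <= 1 -> kap a = s ^+ 2 -> 0 <= lam a ->
  rho a ^+ 2 = lam a * (v a * s) ->
  moment b v kap (i - j) a * (rho a ^+ 2) ^+ j <= moment b v kap i a * lam a ^+ j.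
Proof.
move=> oj ij b0 v0 /andP[s0 s1] kE l0 e.
rewrite e exprMn mulrCA mulrC ler_wpM2r ?exprn_ge0 //.
have bv0 : 0 <= b a + v a by rewrite addr_ge0.
have k1 : kap a <= 1 by rewrite kE expr_le1.
have k0 : 0 <= kap a by rewrite kE exprn_ge0.
case: j oj ij => [|[//|j]] oj ij; first by rewrite subn0 expr0 mulr1.
set d := (i - j.+2)%N; have -> : i = (d + j.+2)%N by rewrite subnK.
rewrite exprMn.
have sj : s ^+ j.+2 <= kap a.
  by rewrite kE -addn2 exprD ler_piMl ?exprn_ge0 // exprn_ile1.
have Mle : moment b v kap d a <= (b a + v a) ^+ d.
  rewrite momentE; have : b a ^+ d <= (b a + v a) ^+ d.
    by rewrite lerXn2r ?nnegrE // lerDl.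
  by move=> h; have := ler_wpM2l (x := 1 - kap a) _ h; rewrite subr_ge0 k1 => /(_ isT); lra.
have M0 : 0 <= moment b v kap d a.
  by rewrite momentE addr_ge0 // mulr_ge0 ?exprn_ge0 // subr_ge0.
(* The middle term is the contribution of the raised state to the [i]-th moment. *)
apply: (@le_trans _ _ ((b a + v a) ^+ d * ((b a + v a) ^+ j.+2 * kap a))).
  apply: ler_pM => //; first by rewrite mulr_ge0 ?exprn_ge0.
  apply: ler_pM; rewrite ?exprn_ge0 //.
  by rewrite lerXn2r ?nnegrE // lerDr.
rewrite mulrA -exprD mulrC momentE lerDr mulr_ge0 ?subr_ge0 //.
by rewrite exprn_ge0.
Qed.

(** * Two choices of parameters for the chi-square bound *)

Section ChiBounds.
Variables (R : realType) (n sp sq : nat) (eps alpha theta beta : R).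
Variable A : algorithm R n sp sq.
Hypothesis eps_gt0 : 0 < eps.
Hypothesis alpha_gt0 : 0 < alpha.
Hypothesis A_test : augmented_closeness_tester eps alpha (2 / 10) A.
Hypothesis beta_gt0 : 0 < beta.
Hypothesis beta_le1 : beta <= 1.
Hypothesis beta_le : beta <= alpha.
Hypothesis theta_far : eps * (1 + beta) < theta.
Hypothesis theta_lt1 : theta < 1.

Let m : R := (sp + sq)%:R.

Let theta_gt0 : 0 < theta.
Proof. by apply: le_lt_trans theta_far; rewrite mulr_ge0 ?addr_ge0 // ltW. Qed.

(** Nothing is raised; [rho = theta / k] over [b = 1 / k] gives [lam = rho^2 / b = theta^2 / k]. *)
Lemma chi_uniform k : (0 < k)%N -> (2 * k <= n)%N ->
  k%:R <= 40 * theta ^+ 4 * m ^+ 2.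
Proof.
move=> k0 kn; have K0 : 0 < k%:R :> R by rewrite ltr0n.
have m0 : 0 <= m by rewrite ler0n.
pose x := m * (theta ^+ 2 / k%:R).
have xk : m * theta ^+ 2 = x * k%:R by rewrite /x; field; rewrite gt_eqF.
have k1 : 1 <= k%:R :> R by rewrite ler1n.
have -> : 40 * theta ^+ 4 * m ^+ 2 = 40 * x ^+ 2 * k%:R ^+ 2.
  by rewrite -[RHS]mulrA -exprMn -xk; ring.
(* The divergence bound requires [m lam = x <= 1/2]; beyond that the claim is immediate from
   [k <= k^2]. *)
have [x_le|x_gt] := lerP x (1 / 2); last first.
  have x2 : 1 / 4 <= x ^+ 2 by nra.
  have k2 : k%:R <= k%:R ^+ 2 :> R by rewrite expr2 ler_peMl // ltW.
  have := ler_wpM2r (ltW (exprn_gt0 2 K0)) x2; lra.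
have sumk c : \sum_(y < k) (c / k%:R) = c :> R.
  by rewrite sumr_const card_ord -[LHS]mulr_natr mulfVK // gt_eqF.
have t0 := ltW theta_gt0; have iK0 : 0 <= k%:R^-1 :> R by rewrite invr_ge0 ltW.
have := @chi_square_tester R n sp sq eps alpha A eps_gt0 alpha_gt0 A_test 'I_k
  (fun=> 1 / k%:R) (fun=> 0) (fun=> 0) (fun=> theta / k%:R)
  (fun=> theta ^+ 2 / k%:R) beta 1.
rewrite card_ord -/m -/x => /(_ kn) h.
have {}h : 1 / 20 < \sum_(y < k) 2 * x ^+ 2.
  apply: h => //.
  - by move=> _; rewrite divr_gt0.
  - by move=> _; rewrite lexx ler01.
  - move=> _; rewrite mulr_ge0 //= ler_pM2r ?invr_gt0 //; exact: ltW.
  - by move=> _; rewrite mulr_ge0 ?sqr_ge0.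
  - by move=> a i j _ ij; apply: moment_lam_const => //; field; rewrite gt_eqF.
  - by rewrite sumk.
  - by move=> _; rewrite addr0 expr1n.
  - by rewrite big1 ?mulr0 ?divr_ge0 ?(ltW beta_gt0) // => a _; rewrite mulr0.
  - by rewrite sumk expr_le1 // ltW.
move: h; rewrite sumr_const card_ord -[X in _ < X -> _]mulr_natr => h.
nra.
Qed.

(** The power is at most [e], the square of [expR (1/2)], and [expR_le_quad] gives
    [expR (1/2) <= 2]. *)
Lemma pow_inv_le4 (k : nat) : (0 < k)%N -> (1 + k%:R^-1) ^+ k <= 4 :> R.
Proof.
move=> k0; have K0 : 0 < k%:R :> R by rewrite ltr0n.
apply: (@le_trans _ _ (expR k%:R^-1 ^+ k)).
  by rewrite lerXn2r ?nnegrE ?expR_ge0 ?expR_ge1Dx // addr_ge0 // invr_ge0 ltW.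
rewrite -expRM_natl mulfV ?gt_eqF //.
have -> : 1 = 2%:R * (1 / 2) :> R by field.
rewrite expRM_natl.
have h : expR (1 / 2 : R) <= 1 + 1 / 2 + 2 * (1 / 2) ^+ 2 by apply: expR_le_quad.
have h0 := expR_gt0 (1 / 2 : R).
nra.
Qed.

(** Each of [N] light elements has base mass [theta / N], all of it perturbed, and may be raised by
    [1 / m], a mass at which one sample is expected there. *)
Lemma chi_heavy N : (0 < N)%N -> (2 * N.+1 <= n)%N -> (0 < sp + sq)%N ->
  160 <= beta ^+ 2 * N%:R * theta ^+ 4 ->
  N%:R ^+ 2 * beta <= 3200 * theta ^+ 4 * m ^+ 3.
Proof.
move=> N0 Nn m_gt0 hreg; rewrite leNgt; apply/negP => hm.
have K0 : 0 < N%:R :> R by rewrite ltr0n.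
have N1 : 1 <= N%:R :> R by rewrite ler1n.
have m0 : 0 < m by rewrite ltr0n.
have t0 := theta_gt0; have t40 : 0 < theta ^+ 4 by rewrite exprn_gt0.
(* If the claim fails, [hreg] forces [m] to be small; this yields [kp <= 1] and a sum of [lam] at
   most 1. *)
have m_le : m <= N%:R * beta / 80.
  have Nb0 : 0 <= N%:R * beta / 80 by rewrite divr_ge0 // mulr_ge0 ?ltW.
  rewrite -(@ler_pXn2r _ 3) ?nnegrE ?(ltW m0) //.
  rewrite -(ler_pM2l (x := 3200 * theta ^+ 4)) ?mulr_gt0 //.
  apply: (le_trans (ltW hm)).
  have -> : 3200 * theta ^+ 4 * (N%:R * beta / 80) ^+ 3
     = (beta ^+ 2 * N%:R * theta ^+ 4) / 160 * (N%:R ^+ 2 * beta) by field.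
  by rewrite ler_peMl ?mulr_ge0 ?exprn_ge0 ?(ltW beta_gt0) ?(ltW K0) //; lra.
(* The largest raise probability that [v_mean] allows with [c = 4]: [4 N kp / m = beta / 20]. *)
pose kp := beta * m / (80 * N%:R); pose s := Num.sqrt kp.
have kp0 : 0 < kp by rewrite divr_gt0 ?mulr_gt0.
have kp1 : kp <= 1.
  rewrite ler_pdivrMr ?mulr_gt0 // mul1r.
  by have := ler_piMl (ltW m0) beta_le1; have := ler_piMr (ltW K0) beta_le1; lra.
have s0 : 0 < s by rewrite sqrtr_gt0.
have s2 : s ^+ 2 = kp by rewrite sqr_sqrtr // ltW.
have s1 : s <= 1 by rewrite -sqrtr1 ler_wsqrtr.
(* Solves [rho^2 = lam v s], the relation asked by [moment_lam_heavy]. *)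
pose l := theta ^+ 2 * m / (N%:R ^+ 2 * s).
have l0 : 0 < l by rewrite divr_gt0 ?mulr_gt0 ?exprn_gt0.
have l2 : l ^+ 2 = 80 * theta ^+ 4 * m / (N%:R ^+ 3 * beta).
  by rewrite /l expr_div_n !exprMn s2 /kp; field; rewrite -?natrD !gt_eqF //.
have sumN c : \sum_(y < N) c = N%:R * c :> R.
  by rewrite sumr_const card_ord -[LHS]mulr_natl.
have sumO (F : option 'I_N -> R) : \sum_a F a = F None + \sum_(y < N) F (Some y).
  rewrite (bigD1 None) //= (reindex_omap Some id) => [|[]] //=.
  by congr (_ + _); apply: eq_bigl => y; rewrite eqxx.
(* [None] is the element that carries the mass [1 - theta] known to the tester. *)
pose ifS (x y : R) (a : option 'I_N) := if a is Some _ then x else y.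
pose b := ifS (theta / N%:R) (1 - theta); pose v := ifS m^-1 0.
pose kap := ifS kp 0; pose rho := ifS (theta / N%:R) 0; pose lam := ifS l 0.
have := @chi_square_tester R n sp sq eps alpha A eps_gt0 alpha_gt0 A_test
  (option 'I_N) b v kap rho lam beta 4.
rewrite card_option card_ord -/m => /(_ Nn) h.
have : 1 / 20 < 2 * (m * 0) ^+ 2 + \sum_(y < N) 2 * (m * l) ^+ 2.
  move: h; rewrite !sumO /b /v /kap /rho /lam /ifS => h; apply: h => //.
  - by move=> [a|] /=; rewrite ?subr_gt0 ?divr_gt0.
  - by rewrite sumN; field; rewrite gt_eqF.
  - by move=> [a|] //; rewrite invr_ge0 ltW.
  - by move=> [a|]; rewrite ?lexx ?ler01 // kp1 ltW.
  - move=> [a|]; rewrite ?lexx ?subr_ge0 ?(ltW theta_lt1) ?andbT //.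
    by rewrite divr_ge0 // ltW.
  - by move=> [a|] //; apply: ltW.
  - move=> [a|] i j oj ij.
      apply: (@moment_lam_heavy _ _ b v kap rho lam (Some a) i j s); rewrite ?(ltW s0) ?s1 //.
      + by rewrite divr_ge0 // ltW.
      + by rewrite invr_ge0 ltW.
      + exact: ltW.
      + by rewrite /rho /lam /v /= /l; field; rewrite -?natrD !gt_eqF //.
    by apply: (@moment_lam_const _ _ b v kap rho lam None i j); rewrite // expr0n mul0r.
  - by rewrite add0r sumN mulrCA divff ?gt_eqF // mulr1.
  - by move=> [a|]; [apply: pow_inv_le4|rewrite addr0 expr1n; lra].
  - rewrite mul0r add0r sumN /kp le_eqVlt; apply/orP; left; apply/eqP.
    by field; rewrite -?natrD !gt_eqF //.
  - rewrite add0r sumN -(@ler_pXn2r _ 2) ?nnegrE ?(ltW (mulr_gt0 K0 l0)) //.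
    rewrite exprMn l2 expr1n.
    have -> : N%:R ^+ 2 * (80 * theta ^+ 4 * m / (N%:R ^+ 3 * beta))
      = theta ^+ 4 * (m * 80 / (N%:R * beta)) by field; rewrite -?natrD !gt_eqF //.
    apply: mulr_ile1.
    + exact: ltW.
    + by rewrite divr_ge0 ?mulr_ge0 ?(ltW m0) ?(ltW beta_gt0) ?(ltW K0).
    + by apply: exprn_ile1; exact: ltW.
    + by rewrite ler_pdivrMr ?mulr_gt0 // mul1r; lra.
  - move=> [a|]; last by rewrite mulr0 divr_ge0.
    rewrite -(@ler_pXn2r _ 2) ?nnegrE ?(ltW (mulr_gt0 m0 l0)) ?divr_ge0 //.
    rewrite exprMn l2.
    have -> : m ^+ 2 * (80 * theta ^+ 4 * m / (N%:R ^+ 3 * beta))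
      = (3200 * theta ^+ 4 * m ^+ 3) / (40 * (N%:R ^+ 3 * beta))
      by field; rewrite -?natrD !gt_eqF //.
    rewrite ler_pdivrMr ?mulr_gt0 ?exprn_gt0 //; apply: (le_trans (ltW hm)).
    have : N%:R ^+ 2 * beta <= N%:R * (N%:R ^+ 2 * beta) :> R.
      by rewrite ler_peMl // mulr_ge0 ?exprn_ge0 ?ltW.
    have -> : N%:R * (N%:R ^+ 2 * beta) = N%:R ^+ 3 * beta :> R by ring.
    have : 0 <= N%:R ^+ 3 * beta :> R by rewrite mulr_ge0 ?exprn_ge0 ?ltW.
    lra.
rewrite mulr0 expr0n mulr0 add0r sumN exprMn l2.
have -> : N%:R * (2 * (m ^+ 2 * (80 * theta ^+ 4 * m / (N%:R ^+ 3 * beta))))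
  = (3200 * theta ^+ 4 * m ^+ 3) / (20 * (N%:R ^+ 2 * beta)) by field; rewrite -?natrD !gt_eqF //.
rewrite ltr_pdivlMr ?mulr_gt0 ?exprn_gt0 //.
lra.
Qed.

End ChiBounds.

(** * Sample bounds *)

Lemma half_bounds n : (2 * n./2 <= n <= 2 * n./2 + 1)%N.
Proof.
by rewrite mul2n -[X in (_ <= X <= _)%N]odd_double_half leq_addl addnC leq_add2l leq_b1.
Qed.

Section SampleBounds.
Variables (R : realType) (n sp sq : nat) (eps alpha xi theta gamma : R).
Variable A : algorithm R n sp sq.
Hypothesis n_ge2 : (2 <= n)%N.
Hypothesis eps_gt0 : 0 < eps.
Hypothesis alpha_gt0 : 0 < alpha.
Hypothesis alpha_le1 : alpha <= 1.
Hypothesis xi_gt0 : 0 < xi.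
Hypothesis A_dp : differentially_private xi A.
Hypothesis A_test : augmented_closeness_tester eps alpha (2 / 10) A.
Hypothesis gamma_gt0 : 0 < gamma.
Hypothesis gamma_le1 : gamma <= 1.
Hypothesis theta_gamma : eps * (1 + gamma) < theta.
Hypothesis theta_le : theta <= 2 * eps.
Hypothesis theta_lt1 : theta < 1.

Let m : R := (sp + sq)%:R.
(** Small enough that [theta] exceeds [eps] even after division by [1 + beta], at the price of a
    factor [1 / gamma] in [closeness_bound]. *)
Let beta : R := gamma * alpha.
Let k := n./2.
Let N : R := n%:R.
Let K : R := k%:R.

Let k_gt0 : (0 < k)%N. Proof. by rewrite half_gt0. Qed.
Let k_le : (2 * k <= n)%N. Proof. by case/andP: (half_bounds n). Qed.
Let beta_gt0 : 0 < beta. Proof. by rewrite mulr_gt0. Qed.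
Let beta_le : beta <= alpha. Proof. by rewrite ler_piMl // ltW. Qed.
Let m_ge0 : 0 <= m. Proof. by rewrite ler0n. Qed.
Let K_gt0 : 0 < K. Proof. by rewrite ltr0n. Qed.
Let N_gt0 : 0 < N. Proof. by rewrite ltr0n (leq_trans _ n_ge2). Qed.

Let N_le1 : N <= 2 * K + 1.
Proof. by rewrite /N /K -natrM natr1 ler_nat -addn1; case/andP: (half_bounds n). Qed.

Let N_le : N <= 3 * K.
Proof.
have h : 1 <= K by rewrite ler1n.
by have := N_le1; lra.
Qed.

Let theta_far : eps * (1 + beta) < theta.
Proof.
apply: le_lt_trans theta_gamma; rewrite ler_wpM2l ?lerD2l ?(ltW eps_gt0) //.
by rewrite ler_piMr // ltW.
Qed.

Let theta_gt_eps : eps < theta.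
Proof.
by apply: le_lt_trans theta_gamma; apply: ler_peMr; rewrite ?lerDl ?(ltW eps_gt0) ?(ltW gamma_gt0).
Qed.

Let theta_eps : eps <= theta. Proof. exact: ltW. Qed.

Let theta_gt0 : 0 < theta. Proof. exact: lt_trans theta_gt_eps. Qed.

Let pow_theta p : theta ^+ p <= 2 ^+ p * eps ^+ p.
Proof. by rewrite -exprMn lerXn2r ?nnegrE ?mulr_ge0 ?(ltW theta_gt0) ?(ltW eps_gt0). Qed.

Let pow_eps p : eps ^+ p <= theta ^+ p.
Proof. by rewrite lerXn2r ?nnegrE ?(ltW theta_gt0) ?(ltW eps_gt0). Qed.

Let card_k : #|'I_k| = k. Proof. exact: card_ord. Qed.
Let ord_gt0 : (0 < #|'I_k|)%N. Proof. by rewrite card_k. Qed.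
Let ord_le : (2 * #|'I_k| <= n)%N. Proof. by rewrite card_k. Qed.

Lemma linear_bound : 1 <= 3 * (m * eps * xi).
Proof.
have := privacy_linear eps_gt0 alpha_gt0 (ltW xi_gt0) A_dp A_test
  ord_gt0 ord_le theta_gt_eps (ltW theta_lt1).
rewrite -/m => h.
have : m * theta * xi <= m * (2 * eps) * xi.
  by rewrite ler_wpM2r ?(ltW xi_gt0) // ler_wpM2l.
lra.
Qed.

Let privacy_bound D : m * (theta / K) <= D \/
    0 < D /\ m * (theta ^+ 2 / K) <= (D / 2) ^+ 2 ->
  4 / 10 <= m * theta * xi * D / 2.
Proof.
move=> hD; apply: (privacy_quadratic eps_gt0 alpha_gt0 (ltW xi_gt0) A_dp A_test
  ord_gt0 ord_le theta_gt_eps (ltW theta_lt1)).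
by rewrite card_k.
Qed.

Lemma m_gt0 : 0 < m.
Proof.
rewrite lt_neqAle m_ge0 andbT; apply/eqP => m0; have := linear_bound.
rewrite -m0 !mul0r mulr0; lra.
Qed.

(** The linear choice [D = m theta / K]; it yields the [sqrt n / (eps sqrt xi)] term. *)
Lemma collision_bound : N <= 15 * (m ^+ 2 * eps ^+ 2 * xi).
Proof.
have := privacy_bound (or_introl (lexx (m * (theta / K)))).
have -> : m * theta * xi * (m * (theta / K)) / 2
  = m ^+ 2 * xi * theta ^+ 2 / 2 / K by field; rewrite gt_eqF.
rewrite ler_pdivlMr // => h.
have : m ^+ 2 * xi * theta ^+ 2 <= m ^+ 2 * xi * (2 ^+ 2 * eps ^+ 2).
  by rewrite ler_wpM2l ?pow_theta // mulr_ge0 ?sqr_ge0 // ltW.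
have := N_le; lra.
Qed.

(** The square-root choice [D = 2 theta sqrt (m / K)]; it yields the term with [n^(1/3)]. *)
Lemma bias_bound : N <= 300 * (m ^+ 3 * eps ^+ 4 * xi ^+ 2).
Proof.
pose s := Num.sqrt (m / K).
have mK : 0 < m / K by rewrite divr_gt0 // m_gt0.
have s0 : 0 < s by rewrite sqrtr_gt0.
have s2 : s ^+ 2 = m / K by rewrite sqr_sqrtr // ltW.
have h : 4 / 10 <= m * theta ^+ 2 * xi * s.
  have := @privacy_bound (2 * theta * s) (or_intror _).
  have -> : m * theta * xi * (2 * theta * s) / 2 = m * theta ^+ 2 * xi * s by field.
  apply; split; first by rewrite !mulr_gt0.
  have -> : (2 * theta * s / 2) ^+ 2 = theta ^+ 2 * s ^+ 2 by field.
  by rewrite s2 mulrCA.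
have h2 : (4 / 10) ^+ 2 <= (m * theta ^+ 2 * xi * s) ^+ 2.
  rewrite lerXn2r ?nnegrE //; first lra.
  by apply: le_trans h; lra.
have e : (m * theta ^+ 2 * xi * s) ^+ 2 = m ^+ 3 * xi ^+ 2 * theta ^+ 4 / K.
  by rewrite exprMn s2; field; rewrite gt_eqF.
move: h2; rewrite e ler_pdivlMr // => h2.
have : m ^+ 3 * xi ^+ 2 * theta ^+ 4 <= m ^+ 3 * xi ^+ 2 * (2 ^+ 4 * eps ^+ 4).
  by rewrite ler_wpM2l ?pow_theta // mulr_ge0 ?exprn_ge0 // ltW.
have := N_le; lra.
Qed.

Lemma uniformity_bound : N <= 1920 * (m ^+ 2 * eps ^+ 4).
Proof.
have := chi_uniform eps_gt0 alpha_gt0 A_test beta_gt0 beta_le theta_far theta_lt1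
  k_gt0 k_le.
rewrite -/m -/K => h.
have : m ^+ 2 * theta ^+ 4 <= m ^+ 2 * (2 ^+ 4 * eps ^+ 4).
  by rewrite ler_wpM2l ?pow_theta ?sqr_ge0.
have := N_le; lra.
Qed.

Lemma closeness_bound : N ^+ 2 * alpha <= 2 * 1000 ^+ 2 / gamma * (m ^+ 3 * eps ^+ 4).
Proof.
have m0 := m_gt0; have e40 : 0 < eps ^+ 4 by rewrite exprn_gt0.
have m30 : 0 < m ^+ 3 by rewrite exprn_gt0.
have KE : K = k.-1%:R + 1 by rewrite natr1 prednK.
have a0 := ltW alpha_gt0; have g0 := ltW gamma_gt0.
rewrite [leRHS]mulrAC ler_pdivlMr //.
(* If [n alpha ^ 2 eps ^ 4] is bounded then [uniformity_bound] is the stronger one. *)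
have [reg|small] := lerP 160 (beta ^+ 2 * k.-1%:R * theta ^+ 4).
  have k1_gt0 : (0 < k.-1)%N.
    rewrite lt0n; apply/eqP => k10; move: reg; rewrite k10 mulr0 mul0r; lra.
  have k1_big : 160 <= k.-1%:R :> R.
    apply: (le_trans reg); rewrite mulrAC ler_piMl //.
    rewrite mulr_ile1 ?exprn_ge0 ?(ltW beta_gt0) ?(ltW theta_gt0) //.
      by rewrite exprn_ile1 ?(ltW beta_gt0) // (le_trans beta_le).
    by rewrite exprn_ile1 ?(ltW theta_gt0) ?(ltW theta_lt1).
  have kS : (2 * k.-1.+1 <= n)%N by rewrite prednK.
  have := chi_heavy eps_gt0 alpha_gt0 A_test beta_gt0 (le_trans beta_le alpha_le1)
    beta_le theta_far theta_lt1 k1_gt0 kS _ reg.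
  rewrite -(ltr0n R) -/m => /(_ m0) h.
  have Nk : N <= 4 * k.-1%:R.
    by have := N_le1; rewrite KE; lra.
  have N2 : N ^+ 2 <= 16 * k.-1%:R ^+ 2.
    have -> : 16 * k.-1%:R ^+ 2 = (4 * k.-1%:R) ^+ 2 :> R by ring.
    by rewrite lerXn2r ?nnegrE ?mulr_ge0 // ltW.
  have : N ^+ 2 * beta <= 16 * k.-1%:R ^+ 2 * beta by rewrite ler_wpM2r // ltW.
  have : m ^+ 3 * theta ^+ 4 <= m ^+ 3 * (2 ^+ 4 * eps ^+ 4).
    by rewrite ler_wpM2l ?pow_theta // ltW.
  have : 0 < m ^+ 3 * eps ^+ 4 by rewrite mulr_gt0.
  have h2 := h; rewrite /beta in h2 *; lra.
have U := uniformity_bound.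
have g2 : gamma ^+ 2 <= 1 by rewrite expr_le1.
have Nk : N <= 2 * k.-1%:R + 3.
  by have := N_le1; rewrite KE; lra.
have ae0 : 0 <= alpha ^+ 2 * eps ^+ 4 by rewrite mulr_ge0 ?sqr_ge0 ?(ltW e40).
have ae1 : alpha ^+ 2 * eps ^+ 4 <= 1.
  apply: mulr_ile1; rewrite ?sqr_ge0 ?(ltW e40) ?exprn_ile1 ?(ltW eps_gt0) //.
  exact: le_trans theta_eps (ltW theta_lt1).
(* [323 = 2 * 160 + 3], from [small] and [N <= 2 (k - 1) + 3]. *)
have key : gamma ^+ 2 * (N * (alpha ^+ 2 * eps ^+ 4)) <= 323.
  have h1 : beta ^+ 2 * k.-1%:R * eps ^+ 4 <= beta ^+ 2 * k.-1%:R * theta ^+ 4.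
    by rewrite ler_wpM2l ?pow_eps // mulr_ge0 ?sqr_ge0.
  have h2 : gamma ^+ 2 * (N * (alpha ^+ 2 * eps ^+ 4))
     <= gamma ^+ 2 * ((2 * k.-1%:R + 3) * (alpha ^+ 2 * eps ^+ 4)).
    by rewrite ler_wpM2l ?sqr_ge0 // ler_wpM2r.
  have h3 : gamma ^+ 2 * (alpha ^+ 2 * eps ^+ 4) <= 1.
    by rewrite mulr_ile1 ?sqr_ge0.
  have e : gamma ^+ 2 * ((2 * k.-1%:R + 3) * (alpha ^+ 2 * eps ^+ 4))
    = 2 * (beta ^+ 2 * k.-1%:R * eps ^+ 4) + 3 * (gamma ^+ 2 * (alpha ^+ 2 * eps ^+ 4)).
    by rewrite /beta; ring.
  lra.
have L0 : 0 <= N ^+ 2 * alpha * gamma by rewrite !mulr_ge0 ?sqr_ge0.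
have R0 : 0 <= 2 * 1000 ^+ 2 * (m ^+ 3 * eps ^+ 4).
  apply: mulr_ge0; first by lra.
  by rewrite ltW // mulr_gt0.
rewrite -(@ler_pXn2r _ 2) ?nnegrE //.
have U3 : N ^+ 3 <= (1920 * (m ^+ 2 * eps ^+ 4)) ^+ 3.
  by apply: lerXn2r => //; rewrite nnegrE ?(ltW N_gt0) ?(le_trans (ltW N_gt0) U).
(* Squaring the claim and multiplying by [eps^4] exposes [N^3] times the left side of [key]; the
   cube of [uniformity_bound] then concludes, as [323 * 1920^3 <= (2 * 1000^2)^2]. *)
rewrite -(ler_pM2r e40).
have -> : (N ^+ 2 * alpha * gamma) ^+ 2 * eps ^+ 4
   = N ^+ 3 * (gamma ^+ 2 * (N * (alpha ^+ 2 * eps ^+ 4))) by ring.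
have N30 : 0 <= N ^+ 3 by rewrite exprn_ge0 // ltW.
apply: (le_trans (ler_wpM2l N30 key)).
have := U3.
have -> : (1920 * (m ^+ 2 * eps ^+ 4)) ^+ 3 = 1920 ^+ 3 * ((m ^+ 3) ^+ 2 * eps ^+ 12) by ring.
have -> : (2 * 1000 ^+ 2 * (m ^+ 3 * eps ^+ 4)) ^+ 2 * eps ^+ 4
  = (2 * 1000 ^+ 2) ^+ 2 * ((m ^+ 3) ^+ 2 * eps ^+ 12) by ring.
have : 0 <= (m ^+ 3) ^+ 2 * eps ^+ 12 by rewrite mulr_ge0 ?sqr_ge0 // exprn_ge0 // ltW.
set T := (m ^+ 3) ^+ 2 * eps ^+ 12; set T' := N ^+ 3; lra.
Qed.

End SampleBounds.

(** * From polynomial inequalities to fractional exponents *)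

Lemma powR_div_expr (R : realType) (x : R) (p q : nat) : 0 <= x -> (0 < q)%N ->
  (x `^ (p%:R / q%:R)) ^+ q = x ^+ p.
Proof.
move=> x0 q0; rewrite -powR_mulrn ?powR_ge0 // -powRrM mulfVK ?powR_mulrn //.
by rewrite pnatr_eq0 -lt0n.
Qed.

(** Since [C >= 1], [C <= C^p]: the root of the constant is not worth keeping. *)
Lemma root_le (R : realType) (T C y : R) p : (0 < p)%N -> 1 <= C -> 0 <= T -> 0 <= y ->
  T ^+ p <= C * y ^+ p -> T <= C * y.
Proof.
move=> p0 C1 T0 y0 h; have C0 : 0 <= C by apply: le_trans C1.
rewrite -(@ler_pXn2r _ p) ?nnegrE ?mulr_ge0 // exprMn; apply: (le_trans h).
by rewrite ler_wpM2r ?exprn_ge0 // ler_eXnr.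
Qed.

(** When [eps = 1] or [n = 1], condition (2) is vacuous and accepting always needs no samples; hence
    [eps <= eps0 < 1] and [2 <= n]. The constant depends on [eps0] through [gamma]. *)
Theorem theorem28 (R : realType) (eps0 : R) (eps0_lt1 : eps0 < 1) :
  exists c : R, 0 < c /\
  forall (n : nat) (eps alpha xi : R),
    (2 <= n)%N -> 0 < eps <= eps0 -> 0 < alpha <= 1 -> 0 < xi ->
  forall (sp sq : nat) (A : algorithm R n sp sq),
    differentially_private xi A ->
    augmented_closeness_tester eps alpha (2 / 10) A ->
    c * (n%:R `^ (2 / 3) * alpha `^ (1 / 3) / eps `^ (4 / 3)
         + Num.sqrt n%:R / eps ^+ 2
         + n%:R `^ (1 / 3) / (eps `^ (4 / 3) * xi `^ (2 / 3))
         + Num.sqrt n%:R / (eps * Num.sqrt xi)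
         + 1 / (eps * xi))
    <= (sp + sq)%:R.
Proof.
pose gamma : R := (1 - eps0) / 4.
pose C : R := 2 * 1000 ^+ 2 / gamma.
have e1 : 0 < 1 - eps0 by rewrite subr_gt0.
have g0 : 0 < gamma by rewrite divr_gt0.
have C0 : 0 < C by rewrite divr_gt0 // mulr_gt0 // exprn_gt0.
have S0 : 0 < C + 1920 + 300 + 15 + 3 by lra.
(* Each of the five terms is at most its own constant times the number of samples. *)
exists (C + 1920 + 300 + 15 + 3)^-1; split; first by rewrite invr_gt0.
move=> n eps alpha xi n2 /andP[eps_gt0 eps_le] /andP[a0 a1] xi0 sp sq A dp test.
have p0 : 0 < eps0 by apply: lt_le_trans eps_le.
have g1 : gamma <= 1 by rewrite /gamma; lra.
(* Below 1 because [2 eps <= 2 eps0 < 1 + eps0], and above [eps (1 + gamma)] because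
   [(1 - eps0) (3 - eps0) > 0]. *)
pose theta := 2 / (1 + eps0) * eps.
have q0 : 0 < 1 + eps0 by lra.
have theta_gamma : eps * (1 + gamma) < theta.
  rewrite /theta mulrC ltr_pM2r // ltr_pdivlMr // /gamma.
  have : 0 < (1 - eps0) * (3 - eps0) by rewrite mulr_gt0; lra.
  lra.
have theta_le : theta <= 2 * eps.
  by rewrite ler_wpM2r ?(ltW eps_gt0) // ler_pdivrMr //; lra.
have theta_lt1 : theta < 1.
  by rewrite /theta mulrAC ltr_pdivrMr // mul1r; lra.
rewrite ler_pdivrMl //.
have B1 := closeness_bound n2 eps_gt0 a0 a1 xi0 dp test g0 g1 theta_gamma
  theta_le theta_lt1.
have B2 := uniformity_bound n2 eps_gt0 a0 a1 test g0 g1 theta_gamma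
  theta_le theta_lt1.
have B3 := bias_bound n2 eps_gt0 a0 xi0 dp test g0 theta_gamma
  theta_le theta_lt1.
have B4 := collision_bound n2 eps_gt0 a0 xi0 dp test g0 theta_gamma
  theta_le theta_lt1.
have B5 := linear_bound n2 eps_gt0 a0 xi0 dp test g0 theta_gamma
  theta_le theta_lt1.
move: B1 B2 B3 B4 B5; rewrite -/C.
set m : R := (sp + sq)%:R; have m0 : 0 <= m by rewrite ler0n.
set N : R := n%:R; have N0 : 0 <= N by rewrite ler0n.
have e0 := ltW eps_gt0; have x0 := ltW xi0.
have C1 : 1 <= C by rewrite ler_pdivlMr // mul1r; lra.
move=> B1 B2 B3 B4 B5.
have sqN : Num.sqrt N ^+ 2 = N by rewrite sqr_sqrtr.
have sqx : Num.sqrt xi ^+ 2 = xi by rewrite sqr_sqrtr // ltW.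
have pow3 (x : R) (p : nat) : 0 <= x -> (x `^ (p%:R / 3)) ^+ 3 = x ^+ p.
  by move=> x_ge0; apply: powR_div_expr.
have pow31 (x : R) : 0 <= x -> (x `^ (1 / 3)) ^+ 3 = x.
  by move=> x_ge0; rewrite (pow3 x 1%N).
have T1 : N `^ (2 / 3) * alpha `^ (1 / 3) / eps `^ (4 / 3) <= C * m.
  apply: (@root_le _ _ _ _ 3) => //; first by rewrite !mulr_ge0 ?invr_ge0 ?powR_ge0.
  rewrite expr_div_n exprMn (pow3 N 2%N) // (pow31 alpha (ltW a0)) (pow3 eps 4%N) //.
  by rewrite ler_pdivrMr ?exprn_gt0 // -[leRHS]mulrA.
have T2 : Num.sqrt N / eps ^+ 2 <= 1920 * m.
  apply: (@root_le _ _ _ _ 2) => //; first lra.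
    by rewrite mulr_ge0 ?invr_ge0 ?sqrtr_ge0 ?sqr_ge0.
  by rewrite expr_div_n sqN -exprM ler_pdivrMr ?exprn_gt0 // -[leRHS]mulrA.
have T3 : N `^ (1 / 3) / (eps `^ (4 / 3) * xi `^ (2 / 3)) <= 300 * m.
  apply: (@root_le _ _ _ _ 3) => //; first lra.
    by rewrite mulr_ge0 ?invr_ge0 ?mulr_ge0 ?powR_ge0.
  rewrite expr_div_n exprMn pow31 // (pow3 eps 4%N) // (pow3 xi 2%N) //.
  by rewrite ler_pdivrMr ?mulr_gt0 ?exprn_gt0 // -[leRHS]mulrA (mulrA (m ^+ 3)).
have T4 : Num.sqrt N / (eps * Num.sqrt xi) <= 15 * m.
  apply: (@root_le _ _ _ _ 2) => //; first lra.
    by rewrite mulr_ge0 ?invr_ge0 ?mulr_ge0 ?sqrtr_ge0.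
  rewrite expr_div_n exprMn sqN sqx ler_pdivrMr ?mulr_gt0 ?exprn_gt0 //.
  by rewrite -[leRHS]mulrA (mulrA (m ^+ 2)).
have T5 : 1 / (eps * xi) <= 3 * m.
  by rewrite ler_pdivrMr ?mulr_gt0 // -[leRHS]mulrA (mulrA m).
lra.
Qed.
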